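(* Let $x_1,\dots,x_m$ be pairwise different nonzero real numbers, let $z_1,\dots,z_n\in\mathbb{C}\setminus\mathbb{R}$ be pairwise different, let $k_1,\dots,k_m,l_1,\dots,l_n$ be positive integers, and let $$Q(x)=\prod_{i=1}^{m}(x-x_i)^{k_i}\prod_{j=1}^{n}\left(x^2-2\operatorname{Re}(z_j)x+|z_j|^2\right)^{l_j},$$ where the quadratic factors $x^2-2\operatorname{Re}(z_j)x+|z_j|^2$ are pairwise different. Let $P$ be a polynomial with real coefficients and $\deg P<\deg Q$, and let $a_{ir}\in\mathbb{R}$, $b_{js}\in\mathbb{C}$ be the coefficients of the complex partial fraction decomposition $$\frac{P(x)}{Q(x)}=\sum_{i=1}^{m}\sum_{r=1}^{k_i}\frac{a_{ir}}{(x-x_i)^r}+\sum_{j=1}^{n}\sum_{s=1}^{l_j}\left(\frac{b_{js}}{(x-z_j)^s}+\frac{\overline{b_{js}}}{(x-\overline{z_j})^s}\right).$$ Let $z>0$, $\operatorname{Re}(\eta)>0$ and $\operatorname{Re}(\alpha)>0$. Then $$\begin{aligned}{}_{\mu,\sigma}D_{v,q;z}^{\alpha,\eta,p}\left(\frac{P(z)}{Q(z)}\right)={}&\sum_{i=1}^{m}\sum_{r=1}^{k_i}\frac{a_{ir}\,B(\eta,\alpha-1)\,z^{\eta+\alpha}}{(-x_i)^{r}\,\Gamma(\alpha)}F_{v,q;p}^{(\mu,\sigma)}\left(r,\eta;\eta+\alpha-1;\frac{z}{x_i}\right)\\&+\sum_{j=1}^{n}\sum_{s=1}^{l_j}\Bigg(b_{js}\frac{B(\eta,\alpha-1)\,z^{\eta+\alpha}}{(-z_j)^{s}\,\Gamma(\alpha)}F_{v,q;p}^{(\mu,\sigma)}\left(s,\eta;\eta+\alpha-1;\frac{z}{z_j}\right)\\&\qquad\qquad+\overline{b_{js}}\,\frac{B(\eta,\alpha-1)\,z^{\eta+\alpha}}{(-\overline{z_j})^{s}\,\Gamma(\alpha)}F_{v,q;p}^{(\mu,\sigma)}\left(s,\eta;\eta+\alpha-1;\frac{z}{\overline{z_j}}\right)\Bigg)\end{aligned}$$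 whenever the extended hypergeometric functions $F_{v,q;p}^{(\mu,\sigma)}$ on the right-hand side exist.
   Context: The extended modified Bessel function is $$I_{v}(q;x)=\frac{\left(\frac{x}{2}\right)^{v}}{\sqrt{\pi}\,\Gamma\left(v+\frac12\right)}\int_{-1}^{1}(1-t^{2})^{v-\frac12}(1-t)^{q-\frac12}\exp(-x(t-1))\,dt$$ for $\operatorname{Re}(v+q)>0$, $\operatorname{Re}(v)>-\frac12$, and equals $\frac{(x/2)^v2^{2v+q-1/2}\Gamma(v+q)}{\sqrt\pi\,\Gamma(2v+q+1/2)}\,{}_1F_1(v+q,2v+q+\frac12,2x)$, which is used for other parameters; powers are principal. The extended beta-hypergeometric function is $$B_{v,q}^{(\mu,\sigma)}(x,y;p)=\sqrt{\frac{2}{\pi}}\int_{0}^{1}t^{x}(1-t)^{y}\,I_{v+\frac12}\left(q;\frac{-p}{t^{\mu}(1-t)^{\sigma}}\right)dt ,\quad \operatorname{Re}(x+\mu q)>-1,\ \operatorname{Re}(y+\sigma q)>-1.$$ With $B(\cdot,\cdot)$ the Euler beta function and $\operatorname{Re}(c)>\operatorname{Re}(b)>0$, $$F_{v,q;p}^{(\mu,\sigma)}(a,b;c;w)=\sum_{k=0}^{\infty}(a)_{k}\frac{B_{v,q}^{(\mu,\sigma)}(b+k,c-b;p)}{B(b,c-b)}\frac{w^{k}}{k!}\quad(|w|<1),$$ extended to $|\arg(1-w)|<\pi$ by analytic continuation. ''$F$ exists'' means that its defining conditions hold, in particular $\operatorname{Re}(c)>\operatorname{Re}(b)>0$, the functions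 $B_{v,q}^{(\mu,\sigma)}(b+k,c-b;p)$ exist, and $w\notin[1,\infty)$. For $z>0$, the extended fractional derivative of $f$ is $${}_{\mu,\sigma}D_{v,q;z}^{\alpha,\eta,p}(f(z))=\frac{\sqrt{2/\pi}}{\Gamma(\alpha)}\int_{0}^{z}f(t)(z-t)^{\alpha-1}t^{\eta}\,I_{v+\frac12}\left(q;\frac{-p\,z^{\mu+\sigma}}{t^{\mu}(z-t)^{\sigma}}\right)dt .$$ Standing assumptions: $\operatorname{Re}(\alpha)>0$, $\operatorname{Re}(p)>0$, $\operatorname{Re}(\eta)>0$, $\operatorname{Re}(v+q+\frac12)>0$, $\operatorname{Re}(2v+q+\frac32)>0$, $\mu,\sigma\ge0$. *)

(* Defs.v *)
From HB Require Import structures.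
From mathcomp Require Import all_boot all_order all_algebra.
From mathcomp Require Import all_classical all_reals all_analysis.
From mathcomp Require Import complex.

Set Implicit Arguments.
Unset Strict Implicit.
Unset Printing Implicit Defensive.

Import Order.TTheory GRing.Theory Num.Theory.
Import numFieldNormedType.Exports.

Local Open Scope classical_set_scope.
Local Open Scope ring_scope.
Local Open Scope complex_scope.

Section ComplexAnalysis.
Variable R : realType.
Implicit Types (z w s : R[i]) (f g : R[i] -> R[i]) (u : nat -> R[i]).

Definition cexp z : R[i] :=
  (expR (complex.Re z))%:C * (cos (complex.Im z) +i* sin (complex.Im z)).

(* The argument of z != 0 in ]-pi, pi]; negative reals get pi. *)
Definition carg z : R :=
  let t := acos (complex.Re z / Normc.normc z) in
  if 0 <= complex.Im z then t else - t.

(* Principal branch of z ^ s. *)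
Definition cpow z s : R[i] :=
  if z == 0 then (s == 0)%:R
  else cexp (s * (ln (Normc.normc z) +i* carg z)).

Definition cintegral (D : set R) (h : R -> R[i]) : R[i] :=
  (\int[@lebesgue_measure R]_(t in D) complex.Re (h t))
    +i* (\int[@lebesgue_measure R]_(t in D) complex.Im (h t)).

(* R[i]^o carries the topology of the complex norm. *)
Definition csum u : R[i] := limn (series (u : nat -> R[i]^o)).

Definition analytic_at g w0 : Prop :=
  exists (c : nat -> R[i]) (r : R), 0 < r /\
    forall w, Normc.normc (w - w0) < r ->
      series ((fun n => c n * (w - w0) ^+ n) : nat -> R[i]^o) @ \oo
        --> (g w : R[i]^o).

Definition poch z (n : nat) : R[i] := \prod_(i < n) (z + i%:R).

(* Euler's integral, continued to Re z <= 0 (away from the poles) by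
   Gamma z = Gamma (z + n) / (z)_n; here n = 0 as soon as 0 < Re z. *)
Definition cGamma z : R[i] :=
  let n := Num.truncn (1 - complex.Re z) in
  cintegral `]0, +oo[ (fun t => cpow t%:C (z + n%:R - 1) * (expR (- t))%:C)
    / poch z n.

Definition cBeta z w : R[i] :=
  cintegral `]0, 1[ (fun t => cpow t%:C (z - 1) * cpow (1 - t)%:C (w - 1)).

Definition hyp1F1 a b z : R[i] :=
  csum (fun n => poch a n / poch b n * z ^+ n / n`!%:R).

End ComplexAnalysis.

Section ExtendedFunctions.
Variable R : realType.
Implicit Types (v q p a b c w x y alpha eta : R[i]) (mu sigma : R).

(* The extended modified Bessel function I_v(q; x). *)
Definition eBesselI v q x : R[i] :=
  if (0 < complex.Re (v + q)) && (- 2^-1 < complex.Re v) then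
    cpow (x / 2) v / ((Num.sqrt pi)%:C * cGamma (v + 2^-1)) *
    cintegral `]-1, 1[ (fun t : R =>
      cpow (1 - t ^+ 2)%:C (v - 2^-1) * cpow (1 - t)%:C (q - 2^-1) *
      cexp (- x * (t - 1)%:C))
  else
    cpow (x / 2) v * cpow 2 (2 * v + q - 2^-1) * cGamma (v + q) /
    ((Num.sqrt pi)%:C * cGamma (2 * v + q + 2^-1)) *
    hyp1F1 (v + q) (2 * v + q + 2^-1) (2 * x).

Definition eBeta mu sigma v q p x y : R[i] :=
  (Num.sqrt (2 / pi))%:C *
  cintegral `]0, 1[ (fun t : R =>
    cpow t%:C x * cpow (1 - t)%:C y *
    eBesselI (v + 2^-1) q (- p / (t `^ mu * (1 - t) `^ sigma)%:C)).

Definition eBeta_exists mu sigma q x y : Prop :=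
  -1 < complex.Re (x + mu%:C * q) /\ -1 < complex.Re (y + sigma%:C * q).

Definition eHyp_series mu sigma v q p a b c w : R[i] :=
  csum (fun k => poch a k *
    (eBeta mu sigma v q p (b + k%:R) (c - b) / cBeta b (c - b)) *
    (w ^+ k / k`!%:R)).

(* In R[i], 1 <= w means that w is real and at least 1, so ~~ (1 <= w) says
   that w lies in the plane cut along [1, +oo[, i.e. |arg (1 - w)| < pi. *)
Definition eHyp_continuation mu sigma v q p a b c (g : R[i] -> R[i]) : Prop :=
  (forall w, ~~ (1 <= w) -> analytic_at g w) /\
  (forall w, `|w| < 1 -> g w = eHyp_series mu sigma v q p a b c w).

(* On the cut plane this is the analytic continuation of the series, which is
   unique there; the series itself is only the default value for the case where
   no continuation exists. *)
Definition eHyp mu sigma v q p a b c : R[i] -> R[i] :=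
  xget (eHyp_series mu sigma v q p a b c)
    [set g | eHyp_continuation mu sigma v q p a b c g].

Definition eHyp_exists mu sigma q b c w : Prop :=
  [/\ 0 < complex.Re b, complex.Re b < complex.Re c,
      forall k : nat, eBeta_exists mu sigma q (b + k%:R) (c - b)
    & ~~ (1 <= w)].

Definition eFracDeriv mu sigma v q alpha eta p (f : R -> R[i]) (z : R) : R[i] :=
  (Num.sqrt (2 / pi))%:C / cGamma alpha *
  cintegral `]0, z[ (fun t : R =>
    f t * cpow (z - t)%:C (alpha - 1) * cpow t%:C eta *
    eBesselI (v + 2^-1) q
      (- p * (z `^ (mu + sigma))%:C / (t `^ mu * (z - t) `^ sigma)%:C)).

End ExtendedFunctions.

Definition real_quadratic (R : realType) (z : R[i]) : {poly R} :=
  'X^2 - (2 * complex.Re z) *: 'X + ((Normc.normc z) ^+ 2)%:P.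

(* Main.v *)
Require Import Defs.
From HB Require Import structures.
From mathcomp Require Import all_boot all_order all_algebra.
From mathcomp Require Import all_classical all_reals all_analysis.
From mathcomp Require Import measurable_realfun complex.
From mathcomp Require Import ring lra.

Set Implicit Arguments.
Unset Strict Implicit.
Unset Printing Implicit Defensive.

Import Order.TTheory GRing.Theory Num.Theory.
Import numFieldNormedType.Exports.

Local Open Scope classical_set_scope.
Local Open Scope ring_scope.
Local Open Scope complex_scope.

(** The substitution [t = z u] turns the fractional derivative of [f] into
    [z ^ (eta + alpha)] times the integral over [0 < u < 1] of [K u * f (z u)],
    where
    [K u = u ^ eta (1 - u) ^ (alpha - 1) I_(v + 1/2)(q; - p / (u ^ mu (1 - u) ^ sigma))]
    is the kernel of the extended beta function: the powers of [z] inside the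
    Bessel function cancel ([eFracDeriv_scale]). On [0 < t < z] the rational
    function is the sum of its simple fractions, because the existence of
    [F(z / x_i)] keeps the poles [x_i] out of this interval, and
    [1 / (z u - x) ^ r = (- x) ^ (- r) (1 - u w) ^ (- r)] with [w = z / x]. By
    linearity it remains to recognize the integral of [K u / (1 - u w) ^ r] as
    [B(eta, alpha - 1) / sqrt (2 / pi)] times [F(r, eta; eta + alpha - 1; w)]
    ([eHyp_stieltjes], [pole_term]). This takes three facts.

    The kernel is integrable ([cinteg_ekernel]). In both cases of its definition,
    [I_v(q; x)] is a constant times [x ^ v 1F1(v + q; 2 v + q + 1/2; 2 x)], and
    [1F1(a; b; - p s)] is [O(s ^ (- lam))] for every [lam < Re a]
    ([hyp1F1_decay]): when [Re (b - a) > 0] this is read off Euler's integral, and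
    the general case follows by raising [b] with a contiguous relation. Hence
    [K] is dominated by a beta density whose exponents are as close as desired to
    [Re (eta + mu q)] and [Re (alpha - 1 + sigma q)], both larger than [-1].

    The integral of [K u / (1 - u w) ^ r] is analytic in [w] on the plane cut along
    [[1, +oo[]; its expansion at [0] is the series defining [F]
    ([stieltjes_series]), and a function on the cut plane is determined by its
    values on the unit disc ([slit_identity]). So it is the continuation of [F].

    Finally [B(eta, alpha - 1)] is not zero ([cBeta_neq0]), so that multiplying
    and dividing by it is harmless. *)

Local Notation re := complex.Re.
Local Notation im := complex.Im.
Local Notation nm := Normc.normc.

(** * Norm and convergence of complex numbers *)

Section ComplexNorm.
Variable R : realType.
Implicit Types (c z w : R[i]) (u : nat -> R[i]).

Lemma normr_nmE z : `|z| = (nm z)%:C.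
Proof. by case: z. Qed.

Lemma nm_ge0 z : 0 <= nm z.
Proof. by rewrite -ler0c -normr_nmE. Qed.

Lemma nmM z w : nm (z * w) = nm z * nm w.
Proof. exact: Normc.normcM. Qed.

Lemma nmD z w : nm (z + w) <= nm z + nm w.
Proof. by rewrite -lecR rmorphD /= -!normr_nmE ler_normD. Qed.

Lemma nmN z : nm (- z) = nm z.
Proof. by apply: (@complexI R); rewrite -!normr_nmE normrN. Qed.

Lemma nm_sub z w : nm (z - w) = nm (w - z).
Proof. by rewrite -nmN opprB. Qed.

Lemma nmV z : nm z^-1 = (nm z)^-1.
Proof. exact: Normc.normcV. Qed.

Lemma nm0 : nm (0 : R[i]) = 0. Proof. exact: Normc.normc0. Qed.
Lemma nm1 : nm (1 : R[i]) = 1. Proof. exact: Normc.normc1. Qed.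

Lemma nm_eq0 z : (nm z == 0) = (z == 0).
Proof.
by apply/eqP/eqP => [|->]; [exact: Normc.eq0_normc | exact: nm0].
Qed.

Lemma nm_gt0 z : (0 < nm z) = (z != 0).
Proof. by rewrite lt_neqAle nm_ge0 andbT eq_sym nm_eq0. Qed.

Lemma nmX z n : nm (z ^+ n) = nm z ^+ n.
Proof. by elim: n => [|n ih]; rewrite ?expr0 ?nm1// !exprS nmM ih. Qed.

Lemma nmR (x : R) : nm x%:C = `|x|.
Proof. by rewrite /= expr0n /= addr0 sqrtr_sqr. Qed.

Lemma nm_nat n : nm (n%:R : R[i]) = n%:R.
Proof. by rewrite -(rmorph_nat (real_complex R)) nmR ger0_norm. Qed.

Lemma le_re_nm z : `|re z| <= nm z.
Proof. by rewrite -lecR -normr_nmE normc_ge_Re. Qed.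

Lemma le_im_nm z : `|im z| <= nm z.
Proof.
case: z => a b /=; rewrite -(sqrtr_sqr b) ler_wsqrtr// lerDr.
exact: sqr_ge0.
Qed.

Lemma nm_le_reim z : nm z <= `|re z| + `|im z|.
Proof.
rewrite {1}(complexE z) (le_trans (nmD _ _))// nmM !nmR.
by rewrite /= expr0n /= add0r expr1n sqrtr1 mul1r.
Qed.

Lemma reD z w : re (z + w) = re z + re w. Proof. by case: z w => ? ? []. Qed.
Lemma imD z w : im (z + w) = im z + im w. Proof. by case: z w => ? ? []. Qed.
Lemma reN z : re (- z) = - re z. Proof. by case: z. Qed.
Lemma imN z : im (- z) = - im z. Proof. by case: z. Qed.
Lemma reB z w : re (z - w) = re z - re w. Proof. by rewrite reD reN. Qed.
Lemma imB z w : im (z - w) = im z - im w. Proof. by rewrite imD imN. Qed.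
Lemma reM z w : re (z * w) = re z * re w - im z * im w.
Proof. by case: z w => ? ? []. Qed.
Lemma imM z w : im (z * w) = re z * im w + im z * re w.
Proof. by case: z w => ? ? []. Qed.

Lemma re_nat n : re (n%:R : R[i]) = n%:R.
Proof. by rewrite -(rmorph_nat (real_complex R)). Qed.
Lemma cvg_nmP u z : ((u : nat -> R[i]^o) @ \oo --> (z : R[i]^o)) <->
  ((fun n => nm (u n - z)) @ \oo --> (0 : R)).
Proof.
split=> [/cvgrPdist_lt h|/cvgrPdist_lt h]; apply/cvgrPdist_lt.
- move=> e e0; have := h e%:C; rewrite ltcR => /(_ e0); apply: filterS => n.
  move=> hn; have {hn} : `|z - u n : R[i]| < e%:C by exact: hn.
  by rewrite normr_nmE ltcR nm_sub sub0r normrN ger0_norm ?nm_ge0.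
- move=> e; case: e => e e'; rewrite ltcE /= => /andP[/eqP -> e0].
  apply: filterS (h e e0) => n.
  rewrite sub0r normrN ger0_norm ?nm_ge0// nm_sub -ltcR -normr_nmE; exact.
Qed.

Lemma cvg0_le (a_ b_ : nat -> R) : (forall n, 0 <= a_ n <= b_ n) ->
  b_ @ \oo --> (0 : R) -> a_ @ \oo --> (0 : R).
Proof.
move=> ab; apply: (@squeeze_cvgr _ _ _ _ (fun=> 0)); last exact: cvg_cst.
exact: nearW.
Qed.

Lemma cvg_distP (x_ : nat -> R) (x : R) : (x_ @ \oo --> x) <->
  ((fun n => `|x_ n - x|) @ \oo --> (0 : R)).
Proof.
split=> [h|h]; first by apply/norm_cvg0P; apply/subr_cvg0.
by apply/subr_cvg0; apply/norm_cvg0P.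
Qed.

(** Real sequences carry the analysis: limits, measurability and dominated
    convergence are all transported to complex values through this equivalence. *)
Lemma cvg_reimP u z : ((u : nat -> R[i]^o) @ \oo --> (z : R[i]^o)) <->
  ((fun n => re (u n)) @ \oo --> re z /\ (fun n => im (u n)) @ \oo --> im z).
Proof.
split => [/cvg_nmP h|[/cvg_distP h1 /cvg_distP h2]].
- split; apply/cvg_distP;
  apply: (cvg0_le _ h) => n /=.
  + by rewrite normr_ge0 /= -reB le_re_nm.
  + by rewrite normr_ge0 /= -imB le_im_nm.
- have h : (fun n => `|re (u n) - re z| + `|im (u n) - im z|) @ \oo --> (0 : R).
    by rewrite -[0]addr0; exact: cvgD.
  apply/cvg_nmP.
  apply: (cvg0_le _ h) => n /=.
  by rewrite nm_ge0 /= -reB -imB nm_le_reim.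
Qed.

Lemma cvgC_unique u z w : (u : nat -> R[i]^o) @ \oo --> (z : R[i]^o) ->
  (u : nat -> R[i]^o) @ \oo --> (w : R[i]^o) -> z = w.
Proof.
move=> /cvg_reimP[a1 b1] /cvg_reimP[a2 b2].
apply/eqP; rewrite eq_complex; apply/andP; split; apply/eqP.
- exact: (cvg_unique _ a1 a2).
- exact: (cvg_unique _ b1 b2).
Qed.

Lemma cvgC_Ml c u z : (u : nat -> R[i]^o) @ \oo --> (z : R[i]^o) ->
  ((fun n => c * u n) : nat -> R[i]^o) @ \oo --> (c * z : R[i]^o).
Proof.
move=> /cvg_nmP h; apply/cvg_nmP; under eq_fun do rewrite -mulrBr nmM.
by rewrite -[0](mulr0 (nm c)); apply: cvgMr.
Qed.

Lemma cvgC_D u u' z z' : (u : nat -> R[i]^o) @ \oo --> (z : R[i]^o) ->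
  (u' : nat -> R[i]^o) @ \oo --> (z' : R[i]^o) ->
  ((fun n => u n + u' n) : nat -> R[i]^o) @ \oo --> (z + z' : R[i]^o).
Proof.
move=> /cvg_reimP[a b] /cvg_reimP[a' b']; apply/cvg_reimP; split.
- by under eq_fun do rewrite reD; rewrite reD; exact: cvgD.
- by under eq_fun do rewrite imD; rewrite imD; exact: cvgD.
Qed.

Lemma eq_cvgC u u' z : (forall n, u n = u' n) ->
  (u : nat -> R[i]^o) @ \oo --> (z : R[i]^o) ->
  (u' : nat -> R[i]^o) @ \oo --> (z : R[i]^o).
Proof. by move=> /funext ->. Qed.

Lemma cvgC_shiftS u z : ((fun n => u n.+1) : nat -> R[i]^o) @ \oo --> (z : R[i]^o) <->
  (u : nat -> R[i]^o) @ \oo --> (z : R[i]^o).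
Proof.
rewrite !cvg_nmP; split; last by move=> h; rewrite (cvg_shiftS (fun n => nm (u n - z))).
by rewrite (cvg_shiftS (fun n => nm (u n - z))).
Qed.

Lemma csumE u z : series (u : nat -> R[i]^o) @ \oo --> (z : R[i]^o) ->
  csum u = z.
Proof. by move=> h; apply: (cvg_lim _ h); exact: norm_hausdorff. Qed.

End ComplexNorm.

(** * Measurable and integrable complex functions *)

Section ComplexIntegral.
Variable R : realType.
Implicit Types (D : set R) (h : R -> R[i]) (c : R[i]).
Local Notation mu := (@lebesgue_measure R).

Definition cmeas D h := measurable_fun D (fun t => re (h t)) /\
  measurable_fun D (fun t => im (h t)).

(** Integrability of both components is what makes [cintegral], which is defined
    componentwise, additive. *)
Definition cinteg D h := mu.-integrable D (EFin \o (fun t => re (h t))) /\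
  mu.-integrable D (EFin \o (fun t => im (h t))).

Lemma cinteg_cmeas D h : cinteg D h -> cmeas D h.
Proof.
by case=> h1 h2; split; apply/measurable_EFinP; [exact: measurable_int h1|
  exact: measurable_int h2].
Qed.

Lemma eq_cmeas D h1 h2 : (forall t, D t -> h1 t = h2 t) ->
  cmeas D h1 -> cmeas D h2.
Proof.
move=> h12 [m1 m2]; split.
- by apply: eq_measurable_fun m1 => t /set_mem/h12 ->.
- by apply: eq_measurable_fun m2 => t /set_mem/h12 ->.
Qed.

Lemma eq_cinteg D h1 h2 : measurable D -> (forall t, D t -> h1 t = h2 t) ->
  cinteg D h1 -> cinteg D h2.
Proof.
move=> mD h12 [m1 m2]; split.
- by apply: eq_integrable m1 => // t /set_mem/h12 /= ->.
- by apply: eq_integrable m2 => // t /set_mem/h12 /= ->.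
Qed.

Lemma eq_cintegral D h1 h2 : (forall t, D t -> h1 t = h2 t) ->
  cintegral D h1 = cintegral D h2.
Proof.
by move=> h12; congr (_ +i* _); apply: eq_Rintegral => t /set_mem/h12 ->.
Qed.

Lemma cmeas_cst D c : cmeas D (fun=> c).
Proof. by split; exact: measurable_cst. Qed.

Lemma cmeas_real D (f : R -> R) : measurable_fun D f ->
  cmeas D (fun t => (f t)%:C).
Proof. by move=> mf; split => //=; exact: measurable_cst. Qed.

Lemma cmeasD D h1 h2 : cmeas D h1 -> cmeas D h2 ->
  cmeas D (fun t => h1 t + h2 t).
Proof.
move=> [a1 b1] [a2 b2]; split.
- by under eq_fun do rewrite reD; exact: measurable_funD.
- by under eq_fun do rewrite imD; exact: measurable_funD.
Qed.

Lemma cmeasM D h1 h2 : cmeas D h1 -> cmeas D h2 ->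
  cmeas D (fun t => h1 t * h2 t).
Proof.
move=> [a1 b1] [a2 b2]; split.
- under eq_fun do rewrite reM.
  by apply: measurable_funB; exact: measurable_funM.
- under eq_fun do rewrite imM.
  by apply: measurable_funD; exact: measurable_funM.
Qed.

Lemma cmeasX D h n : cmeas D h -> cmeas D (fun t => h t ^+ n).
Proof.
move=> mh; elim: n => [|n ih]; first exact: cmeas_cst.
by under [X in cmeas _ X]eq_fun do rewrite exprS; exact: cmeasM.
Qed.

Lemma cmeas_sum D n (h_ : nat -> R -> R[i]) : (forall k, cmeas D (h_ k)) ->
  cmeas D (fun t => \sum_(0 <= k < n) h_ k t).
Proof.
move=> mh; elim: n => [|n ih].
  by under [X in cmeas _ X]eq_fun do rewrite big_geq//; exact: cmeas_cst.
by under [X in cmeas _ X]eq_fun do rewrite big_nat_recr//=; exact: cmeasD.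
Qed.

Lemma cmeas_cvg D (h_ : nat -> R -> R[i]) h : (forall n, cmeas D (h_ n)) ->
  (forall t, D t -> (h_ ^~ t : nat -> R[i]^o) @ \oo --> (h t : R[i]^o)) ->
  cmeas D h.
Proof.
move=> mh hh; split.
- apply: (measurable_fun_cvg (fun n => (mh n).1)) => t Dt.
  by have /cvg_reimP[] := hh t Dt.
- apply: (measurable_fun_cvg (fun n => (mh n).2)) => t Dt.
  by have /cvg_reimP[] := hh t Dt.
Qed.

Lemma cinteg_le D h (g : R -> R) : measurable D -> cmeas D h ->
  mu.-integrable D (EFin \o g) -> (forall t, D t -> nm (h t) <= g t) ->
  cinteg D h.
Proof.
move=> mD [a b] ig hg; split.
- apply: le_integrable ig => //; first exact/measurable_EFinP.
  move=> t Dt; rewrite /= lee_fin (le_trans (le_re_nm _))//.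
  by rewrite (le_trans (hg _ Dt))// ler_norm.
- apply: le_integrable ig => //; first exact/measurable_EFinP.
  move=> t Dt; rewrite /= lee_fin (le_trans (le_im_nm _))//.
  by rewrite (le_trans (hg _ Dt))// ler_norm.
Qed.

Lemma integrable_EFinD D (f g : R -> R) : measurable D ->
  mu.-integrable D (EFin \o f) -> mu.-integrable D (EFin \o g) ->
  mu.-integrable D (EFin \o (fun t => f t + g t)).
Proof. by by move=> mD jf jg; exact: (integrableD _ jf jg). Qed.

Lemma integrable_EFinZ D (k : R) (f : R -> R) : measurable D ->
  mu.-integrable D (EFin \o f) ->
  mu.-integrable D (EFin \o (fun t => k * f t)).
Proof. by move=> mD jf; exact: (integrableZl _ k jf). Qed.

Lemma cinteg_nm D h : measurable D -> cinteg D h ->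
  mu.-integrable D (EFin \o (fun t => `|re (h t)| + `|im (h t)|)).
Proof.
by move=> mD [a b]; apply: integrable_EFinD => //; exact: integrable_norm.
Qed.

Lemma cintegD D h1 h2 : measurable D -> cinteg D h1 -> cinteg D h2 ->
  cinteg D (fun t => h1 t + h2 t).
Proof.
move=> mD i1 i2.
apply: (@cinteg_le _ _ (fun t => (`|re (h1 t)| + `|im (h1 t)|) +
   (`|re (h2 t)| + `|im (h2 t)|))) => //.
- by apply: cmeasD; exact: cinteg_cmeas.
- by apply: integrable_EFinD => //; exact: cinteg_nm.
- by move=> t Dt; rewrite (le_trans (nmD _ _))// lerD// nm_le_reim.
Qed.

Lemma cintegZ D h c : measurable D -> cinteg D h -> cinteg D (fun t => c * h t).
Proof.
move=> mD i1.
apply: (@cinteg_le _ _ (fun t => nm c * (`|re (h t)| + `|im (h t)|))) => //.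
- by apply: cmeasM; [exact: cmeas_cst|exact: cinteg_cmeas].
- by apply: integrable_EFinZ => //; exact: cinteg_nm.
- by move=> t Dt; rewrite nmM ler_wpM2l ?nm_ge0// nm_le_reim.
Qed.

Lemma cintegralD D h1 h2 : measurable D -> cinteg D h1 -> cinteg D h2 ->
  cintegral D (fun t => h1 t + h2 t) = cintegral D h1 + cintegral D h2.
Proof.
move=> mD [a1 b1] [a2 b2]; apply/eqP; rewrite eq_complex /= -!RintegralD//.
by apply/andP; split; apply/eqP/eq_Rintegral => t _; rewrite ?reD ?imD.
Qed.

Lemma cintegralZ D h c : measurable D -> cinteg D h ->
  cintegral D (fun t => c * h t) = c * cintegral D h.
Proof.
move=> mD [a b]; case: c => x y; apply/eqP; rewrite eq_complex /=.
rewrite -!RintegralZl//; apply/andP; split; apply/eqP.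
- rewrite -RintegralB//; try exact: integrable_EFinZ.
  by apply: eq_Rintegral => t _; rewrite reM.
- rewrite -RintegralD//; try exact: integrable_EFinZ.
  by apply: eq_Rintegral => t _; rewrite imM.
Qed.

Lemma cintegral0 D : cintegral D (fun=> 0) = 0.
Proof. by rewrite /cintegral /= /Rintegral integral0. Qed.

Lemma cinteg0 D : measurable D -> cinteg D (fun=> 0).
Proof. by move=> mD; split; exact: integrable0. Qed.

Lemma cinteg_sum D (I : Type) (s : seq I) (h_ : I -> R -> R[i]) : measurable D ->
  (forall k, cinteg D (h_ k)) -> cinteg D (fun t => \sum_(k <- s) h_ k t).
Proof.
move=> mD ih; elim: s => [|k s IH].
  by apply: eq_cinteg (cinteg0 mD) => // t _; rewrite big_nil.
by apply: eq_cinteg (cintegD mD (ih k) IH) => // t _; rewrite big_cons.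
Qed.

Lemma cintegral_sum D (I : Type) (s : seq I) (h_ : I -> R -> R[i]) :
  measurable D -> (forall k, cinteg D (h_ k)) ->
  cintegral D (fun t => \sum_(k <- s) h_ k t) =
  \sum_(k <- s) cintegral D (h_ k).
Proof.
move=> mD ih; elim: s => [|k s IH].
  rewrite big_nil -[RHS](cintegral0 D); apply: eq_cintegral => t _.
  by rewrite big_nil.
rewrite big_cons -IH -cintegralD//; last exact: cinteg_sum.
by apply: eq_cintegral => t _; rewrite big_cons.
Qed.

(** The factor 2 comes from bounding the two components separately. *)
Lemma nm_cintegral_le D h (g : R -> R) : measurable D -> cmeas D h ->
  mu.-integrable D (EFin \o g) -> (forall t, D t -> nm (h t) <= g t) ->
  nm (cintegral D h) <= 2 * \int[mu]_(t in D) g t.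
Proof.
move=> mD mh ig hg; have [a b] := cinteg_le mD mh ig hg.
have le_int (f : R -> R) : mu.-integrable D (EFin \o f) ->
    (forall t, `|f t| <= nm (h t)) ->
    `|\int[mu]_(t in D) f t| <= \int[mu]_(t in D) g t.
  move=> jf fh; apply: (le_trans (le_normr_Rintegral _ jf)) => //.
  apply: le_Rintegral => //; first exact: integrable_norm.
  by move=> t Dt; rewrite (le_trans (fh t))// hg.
rewrite (le_trans (nm_le_reim _))// mulr_natl mulr2n.
apply: lerD; apply: le_int => // t; [exact: le_re_nm|exact: le_im_nm].
Qed.

Lemma Rintegral_dominated D (f_ : nat -> R -> R) (f g : R -> R) : measurable D ->
  (forall n, measurable_fun D (f_ n)) ->
  (forall t, D t -> f_ ^~ t @ \oo --> f t) ->
  mu.-integrable D (EFin \o g) ->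
  (forall n t, D t -> `|f_ n t| <= g t) ->
  (fun n => \int[mu]_(t in D) f_ n t) @ \oo --> \int[mu]_(t in D) f t.
Proof.
move=> mD mf ff ig fg.
have mlim : measurable_fun D f by exact: (measurable_fun_cvg mf ff).
have fE t : D t -> (f_ n t)%:E @[n --> \oo] --> (f t)%:E.
  by move=> Dt; apply/fine_cvgP; split; [exact: nearW|exact: ff].
have [|||//||i1 _ c1] := @dominated_convergence _ _ _ mu _ mD
  (fun n => EFin \o f_ n) (EFin \o f) (EFin \o g).
- move=> n; apply/measurable_EFinP. exact: mf.
- exact/measurable_EFinP.
- by apply: aeW => t; exact: fE.
- by apply: aeW => t n Dt /=; rewrite lee_fin fg.
apply: fine_cvg; rewrite fineK; last exact: integrable_fin_num.
exact: c1.
Qed.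

Lemma cintegral_dominated D (h_ : nat -> R -> R[i]) h (g : R -> R) :
  measurable D -> (forall n, cmeas D (h_ n)) ->
  (forall t, D t -> (h_ ^~ t : nat -> R[i]^o) @ \oo --> (h t : R[i]^o)) ->
  mu.-integrable D (EFin \o g) ->
  (forall n t, D t -> nm (h_ n t) <= g t) ->
  ((fun n => cintegral D (h_ n)) : nat -> R[i]^o) @ \oo -->
    (cintegral D h : R[i]^o).
Proof.
move=> mD mh hh ig hg; apply/cvg_reimP; split => /=.
- apply: (Rintegral_dominated mD (fun n => (mh n).1) _ ig).
  + by move=> t Dt; have /cvg_reimP[] := hh t Dt.
  + by move=> n t Dt; rewrite (le_trans (le_re_nm _))// hg.
- apply: (Rintegral_dominated mD (fun n => (mh n).2) _ ig).
  + by move=> t Dt; have /cvg_reimP[] := hh t Dt.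
  + by move=> n t Dt; rewrite (le_trans (le_im_nm _))// hg.
Qed.

End ComplexIntegral.

(** * Affine change of variables *)

Section AffineChange.
Variable R : realType.
Local Notation mu := (@lebesgue_measure R).
Variables (k x0 : R).
Hypothesis k0 : k != 0.

Let phi (u : R) : R := x0 + k * u.

Lemma measurable_affine D : measurable_fun D phi.
Proof.
by apply: measurable_funD; [exact: measurable_cst|exact: mulrl_measurable].
Qed.

Let phiR : measurableTypeR R -> measurableTypeR R := phi.

Let mphiR : measurable_fun [set: measurableTypeR R] phiR.
Proof. exact: measurable_affine. Qed.

Let push : {measure set (measurableTypeR R) -> \bar R} :=
  measure_function_pushforward__canonical__measure_function_Measure mu mphiR.

(** It suffices to compare the two measures on half-open intervals. *)
Let lebesgue_phi (A : set R) : measurable A ->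
  mu A = mscale (NngNum (normr_ge0 k)) push A.
Proof.
apply: lebesgue_measure_unique => _ [[a b]] _ <-.
rewrite [RHS](_ : _ = (`|k|%:E * mu (phiR @^-1` `]a, b]))%E)//.
rewrite lebesgue_measure_itv /= lte_fin.
have [kp|kn] : 0 < k \/ k < 0 by move: k0; rewrite neq_lt => /orP[]; [right|left].
- rewrite (_ : phiR @^-1` _ = `](a - x0) / k, (b - x0) / k]%classic); last first.
    apply/seteqP; split=> u /=; rewrite !in_itv /= /phiR /phi => /andP[h1 h2].
      by rewrite ltr_pdivrMr// ler_pdivlMr//; lra.
    by move: h1 h2; rewrite ltr_pdivrMr// ler_pdivlMr//; lra.
  rewrite lebesgue_measure_itv /= lte_fin ltr_pM2r ?invr_gt0// ltrD2r.
  case: ifPn => _; rewrite ?mule0// -!EFinD -EFinM gtr0_norm//.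
  by congr EFin; field.
- rewrite (_ : phiR @^-1` _ = `[(b - x0) / k, (a - x0) / k[%classic); last first.
    apply/seteqP; split=> u /=; rewrite !in_itv /= /phiR /phi => /andP[h1 h2].
      by rewrite ltr_ndivlMr// ler_ndivrMr//; lra.
    by move: h1 h2; rewrite ltr_ndivlMr// ler_ndivrMr//; lra.
  rewrite lebesgue_measure_itv /= lte_fin ltr_nM2r ?invr_lt0// ltrD2r.
  case: ifPn => _; rewrite ?mule0// -!EFinD -EFinM ltr0_norm//.
  by congr EFin; field.
Qed.

Lemma ge0_integral_affine (D : set R) (f : R -> R) : measurable D ->
  measurable_fun D f -> (forall t, D t -> 0 <= f t) ->
  (\int[mu]_(t in D) (f t)%:E =
   `|k|%:E * \int[mu]_(u in phi @^-1` D) (f (phi u))%:E)%E.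
Proof.
move=> mD mf f0.
rewrite (@eq_measure_integral _ _ _ _
    (mscale (NngNum (normr_ge0 k)) push)); last first.
  by move=> A mA _; exact: lebesgue_phi.
rewrite ge0_integral_mscale//=; last exact/measurable_EFinP.
congr (_ * _)%E.
rewrite (@ge0_integral_pushforward _ _ _ _ _ phiR mphiR mu D (EFin \o f))//.
  exact/measurable_EFinP.
by move=> t /set_mem Dt; rewrite lee_fin f0.
Qed.

Lemma measurable_preimage_affine (D : set R) : measurable D ->
  measurable (phi @^-1` D).
Proof. by move=> mD; rewrite -[X in measurable X]setTI; exact: measurable_affine. Qed.

Lemma integrable_affine (D : set R) (f : R -> R) : measurable D ->
  mu.-integrable D (EFin \o f) ->
  mu.-integrable (phi @^-1` D) (EFin \o (fun u => f (phi u))).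
Proof.
move=> mD /integrableP[/measurable_EFinP mf fi]; apply/integrableP; split.
  apply/measurable_EFinP; apply: (measurable_comp mD _ mf (@measurable_affine _)).
  by move=> _ [u Du <-]; exact: Du.
have mf' : measurable_fun D (fun t => `|f t|) by exact: measurableT_comp.
move: fi; rewrite (ge0_integral_affine mD mf')//=.
have k0' : (0 < `|k|%:E)%E by rewrite lte_fin normr_gt0.
case E : (\int[mu]_(u in phi @^-1` D) _)%E => [r| |].
- by move=> _; rewrite ltry.
- by rewrite gt0_muley// ltxx.
- by [].
Qed.

(** The nonnegative case follows from the scaling of Lebesgue measure; a general
    integrable function is the difference of its positive and negative parts. *)
Lemma Rintegral_affine (D : set R) (f : R -> R) : measurable D ->
  mu.-integrable D (EFin \o f) ->
  \int[mu]_(t in D) f t = `|k| * \int[mu]_(u in phi @^-1` D) f (phi u).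
Proof.
move=> mD fi.
have mf : measurable_fun D f by apply/measurable_EFinP; exact: measurable_int fi.
have ge0 (g : R -> R) : measurable_fun D g -> (forall t, 0 <= g t) ->
    \int[mu]_(t in D) g t = `|k| * \int[mu]_(u in phi @^-1` D) g (phi u).
  move=> mg g0; rewrite /Rintegral ge0_integral_affine//.
  case E : (\int[mu]_(u in phi @^-1` D) _)%E => [r| |] //=.
 
  - by rewrite gt0_muley ?lte_fin ?normr_gt0//= mulr0.
  - by rewrite gt0_muleNy ?lte_fin ?normr_gt0//= mulr0.
pose fp t := Num.max (f t) 0; pose fn t := Num.max (- f t) 0.
have fE t : f t = fp t - fn t.
  by rewrite /fp /fn; case: (ltrP (f t) 0); case: (ltrP (- f t) 0); lra.
have mfp : measurable_fun D fp by apply: measurable_maxr.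
have mfn : measurable_fun D fn.
  by apply: measurable_maxr => //; exact: measurable_funN.
have ip : mu.-integrable D (EFin \o fp).
  apply: le_integrable fi => //; first exact/measurable_EFinP.
  move=> t _ /=; rewrite lee_fin /fp; case: (ltrP (f t) 0) => h //.
  by rewrite normr0.
have jn : mu.-integrable D (EFin \o fn).
  apply: le_integrable fi => //; first exact/measurable_EFinP.
  move=> t _ /=; rewrite lee_fin /fn; case: (ltrP (- f t) 0) => h //.
    by rewrite normr0.
  by rewrite normrN.
under eq_Rintegral do rewrite fE.
under [in RHS]eq_Rintegral do rewrite fE.
have mpD := measurable_preimage_affine mD.
rewrite RintegralB// RintegralB//; try exact: integrable_affine.
rewrite mulrBr !ge0// => t; rewrite /fp /fn ?le_max lexx ?orbT//.
Qed.

Lemma cinteg_affine D (h : R -> R[i]) : measurable D -> cinteg D h ->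
  cinteg (phi @^-1` D) (fun u => h (phi u)).
Proof.
by move=> mD [a b]; split;
  [exact: (integrable_affine mD a)|exact: (integrable_affine mD b)].
Qed.

Lemma cintegral_affine D (h : R -> R[i]) : measurable D -> cinteg D h ->
  cintegral D h = (`|k|)%:C * cintegral (phi @^-1` D) (fun u => h (phi u)).
Proof.
move=> mD [a b]; rewrite /cintegral (Rintegral_affine mD a).
rewrite (Rintegral_affine mD b); apply/eqP.
by rewrite eq_complex /= !mul0r subr0 addr0 !eqxx.
Qed.

End AffineChange.

Section Inverse.
Variable R : realType.
Implicit Types (D : set R) (h : R -> R[i]).

(** On positive numbers the inverse is [expR \o -%R \o ln], whose factors are
    measurable. *)
Lemma measurable_invr D (f : R -> R) : (forall t, D t -> 0 < f t) ->
  measurable_fun D f -> measurable_fun D (fun t => (f t)^-1).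
Proof.
move=> f0 mf; apply: (eq_measurable_fun (fun t => expR (- ln (f t)))).
  by move=> t /set_mem Dt; rewrite expRN lnK// posrE f0.
apply: (measurableT_comp (@measurable_expR R)).
apply: measurable_funN; exact: (measurableT_comp (@measurable_ln R)).
Qed.

Lemma cmeasV D h : (forall t, D t -> h t != 0) -> cmeas D h ->
  cmeas D (fun t => (h t)^-1).
Proof.
move=> h0 [a b].
have m2 : measurable_fun D (fun t => ((re (h t)) ^+ 2 + (im (h t)) ^+ 2)^-1).
  apply: measurable_invr; last by apply: measurable_funD; exact: measurable_funX.
  move=> t /h0; case: (h t) => x y /=; rewrite eq_complex /= negb_and.
  by move=> /orP[] ?; [apply: ltr_wpDr|apply: ltr_wpDl];
    rewrite ?sqr_ge0// exprn_even_gt0.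
split.
- apply: (eq_measurable_fun (fun t => re (h t) *
    ((re (h t)) ^+ 2 + (im (h t)) ^+ 2)^-1)); last exact: measurable_funM.
  by move=> t _; case: (h t).
- apply: (eq_measurable_fun (fun t => - (im (h t) *
    ((re (h t)) ^+ 2 + (im (h t)) ^+ 2)^-1))).
    by move=> t _; case: (h t).
  by apply: measurable_funN; exact: measurable_funM.
Qed.

End Inverse.

(** * Complex exponential and complex powers of positive numbers *)

Section Exponential.
Variable R : realType.
Implicit Types (z w s : R[i]) (t u x : R).

Lemma cexpE z : cexp z = (expR (re z) * cos (im z)) +i* (expR (re z) * sin (im z)).
Proof. by rewrite /cexp; simpc. Qed.

Lemma cexpD z w : cexp (z + w) = cexp z * cexp w.
Proof.
rewrite !cexpE reD imD expRD cosD sinD; apply/eqP; rewrite eq_complex /=.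
by apply/andP; split; apply/eqP; ring.
Qed.

Lemma cexp0 : cexp (0 : R[i]) = 1.
Proof. by rewrite cexpE /= expR0 cos0 sin0 mulr1 mulr0. Qed.

Lemma nm_cexp z : nm (cexp z) = expR (re z).
Proof.
rewrite cexpE /= !exprMn -mulrDr cos2Dsin2 mulr1 sqrtr_sqr.
by rewrite ger0_norm// expR_ge0.
Qed.

Lemma cexp_neq0 z : cexp z != 0.
Proof. by rewrite -nm_gt0 nm_cexp expR_gt0. Qed.

Lemma cexp_real x : cexp x%:C = (expR x)%:C.
Proof. by rewrite cexpE /= cos0 sin0 mulr1 mulr0. Qed.

Lemma cpow_pos t s : 0 < t -> cpow t%:C s = cexp (s * (ln t)%:C).
Proof.
move=> t0; rewrite /cpow eq_complex /= eqxx andbT gt_eqF// expr0n addr0.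
by rewrite sqrtr_sqr gtr0_norm// /carg lexx /= expr0n addr0 sqrtr_sqr gtr0_norm//
  divff ?gt_eqF// acos1.
Qed.

Lemma nm_cpow_pos t s : 0 < t -> nm (cpow t%:C s) = t `^ re s.
Proof.
move=> t0; rewrite cpow_pos// nm_cexp /powR gt_eqF//=.
by case: s => a b /=; rewrite mulr0 subr0.
Qed.

Lemma cpow_neq0 t s : 0 < t -> cpow t%:C s != 0.
Proof. by move=> t0; rewrite cpow_pos// cexp_neq0. Qed.

Lemma cpow_posM t u s : 0 < t -> 0 < u ->
  cpow (t * u)%:C s = cpow t%:C s * cpow u%:C s.
Proof.
move=> t0 u0; rewrite !cpow_pos ?mulr_gt0// -cexpD -mulrDr.
by rewrite lnM ?posrE// rmorphD.
Qed.

Lemma cpow_posD t s w : 0 < t -> cpow t%:C (s + w) = cpow t%:C s * cpow t%:C w.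
Proof. by move=> t0; rewrite !cpow_pos// -cexpD mulrDl. Qed.

Lemma cpow_nat t n : 0 < t -> cpow t%:C n%:R = t%:C ^+ n.
Proof.
move=> t0; rewrite cpow_pos// -(rmorph_nat (real_complex R)) -rmorphM cexp_real.
by rewrite expRM_natl lnK// rmorphXn.
Qed.

Lemma cpow_pos1 t : 0 < t -> cpow t%:C 1 = t%:C.
Proof. by move=> t0; rewrite (cpow_nat 1)// expr1. Qed.

Lemma cpow_posDn t s n : 0 < t -> cpow t%:C (s + n%:R) = cpow t%:C s * t%:C ^+ n.
Proof. by move=> t0; rewrite cpow_posD// cpow_nat. Qed.

(** A positive factor does not change the argument, so no branch correction
    appears even when [z] lies on the cut of the principal branch. *)
Lemma cpow_scale z t s : z != 0 -> 0 < t ->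
  cpow (z * t%:C) s = cpow z s * cpow t%:C s.
Proof.
move=> z0 t0.
have nz : 0 < nm z by rewrite nm_gt0.
have zt0 : z * t%:C != 0 by rewrite -nm_gt0 nmM nmR gtr0_norm ?mulr_gt0.
have cargE : carg (z * t%:C) = carg z.
  rewrite /carg nmM nmR gtr0_norm// reM imM /= !mulr0 subr0 add0r.
  by rewrite pmulr_lge0// invfM mulrACA divff ?mulr1// gt_eqF.
rewrite cpow_pos// /cpow (negPf z0) (negPf zt0) -cexpD -mulrDr.
rewrite cargE nmM nmR gtr0_norm// lnM ?posrE//; congr cexp; congr (_ * _).
by apply/eqP; rewrite eq_complex /= addr0 !eqxx.
Qed.

Lemma cmeas_cexp D (h : R -> R[i]) : cmeas D h -> cmeas D (fun t => cexp (h t)).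
Proof.
move=> [a b].
have me : measurable_fun D (fun t => expR (re (h t))).
  exact: (measurableT_comp (@measurable_expR R)).
split; under eq_fun do rewrite cexpE /=; apply: measurable_funM => //.
- apply: (measurableT_comp _ b); apply: continuous_measurable_fun.
  exact: continuous_cos.
- apply: (measurableT_comp _ b); apply: continuous_measurable_fun.
  exact: continuous_sin.
Qed.

Lemma cmeas_cpow D (f : R -> R) s : (forall t, D t -> 0 < f t) ->
  measurable_fun D f -> cmeas D (fun t => cpow (f t)%:C s).
Proof.
move=> f0 mf; apply: (@eq_cmeas _ _ (fun t => cexp (s * (ln (f t))%:C))).
  by move=> t Dt; rewrite cpow_pos// f0.
apply: cmeas_cexp; apply: cmeasM; first exact: cmeas_cst.
by apply: cmeas_real; exact: (measurableT_comp (@measurable_ln R)).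
Qed.

End Exponential.

(** * The fundamental theorem of calculus on the open unit interval *)

Section FTC.
Variable R : realType.
Local Notation mu := (@lebesgue_measure R).

Local Notation I01 := (`]0, 1[%classic : set R).

(** Starting at [1/3] makes [[cut n, 1 - cut n]] a nondegenerate interval for
    every [n]. *)
Definition cut (n : nat) : R := n.+3%:R^-1.

Lemma cut_gt0 n : 0 < cut n.
Proof. by rewrite invr_gt0. Qed.

Lemma cut_le n : cut n <= 3^-1.
Proof. by rewrite lef_pV2 ?posrE// ler_nat. Qed.

Lemma cvg_cut : cut @ \oo --> (0 : R).
Proof.
have := @cvg_harmonic R; rewrite -(cvg_shiftn 2).
by rewrite (_ : (fun n => _) = cut)//; apply/funext => n; rewrite addn2.
Qed.

Definition cutitv n : set R := `[cut n, 1 - cut n]%classic.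

Variables (F f : R -> R).
Hypothesis dF : forall u : R, 0 < u < 1 -> is_derive u 1 F (f u).
Hypothesis cf : forall u : R, 0 < u < 1 -> {for u, continuous f}.

Lemma FTC_cut n :
  (\int[mu]_(u in cutitv n) (f u)%:E =
   (F (1 - cut n)%R)%:E - (F (cut n))%:E)%E.
Proof.
have c0 := cut_gt0 n; have c3 := cut_le n.
have h3 : 3^-1 * 3 = 1 :> R by rewrite mulVf// pnatr_eq0.
have cF (u : R) : 0 < u < 1 -> {for u, continuous F}.
  move=> /dF[d _]; apply: differentiable_continuous.
  by rewrite -derivable1_diffP.
apply: continuous_FTC2.
- lra.
- apply: continuous_in_subspaceT => u; rewrite inE /= in_itv /= => /andP[h1 h2].
  by apply: cf; lra.
- split.
  + move=> u; rewrite in_itv /= => /andP[h1 h2].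
    by have [] : is_derive u 1 F (f u) by apply: dF; lra.
  + by apply: cvg_at_right_filter; apply: cF; lra.
  + by apply: cvg_at_left_filter; apply: cF; lra.
- move=> u; rewrite in_itv /= => /andP[h1 h2]; rewrite derive1E.
  by have [] : is_derive u 1 F (f u) by apply: dF; lra.
Qed.

Lemma cut_nonincreasing m n : (m <= n)%N -> cut n <= cut m.
Proof. by move=> mn; rewrite lef_pV2 ?posrE// ler_nat !ltnS. Qed.

Lemma cutitv_bigcup : \bigcup_n cutitv n = I01.
Proof.
apply/seteqP; split=> u.
  move=> [n _] /=; rewrite /cutitv /= !in_itv /= => /andP[h1 h2].
  by have c0 := cut_gt0 n; apply/andP; split; lra.
rewrite /= in_itv /= => /andP[u0 u1].
have : \forall n \near \oo, cut n < Num.min u (1 - u).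
  apply: (cvgr_lt _ cvg_cut); rewrite lt_min u0 /=; lra.
move=> [n _ /(_ n (leqnn n)) /=]; rewrite lt_min => /andP[h1 h2].
by exists n => //; rewrite /cutitv /= in_itv /=; apply/andP; split; lra.
Qed.

Let f_meas : measurable_fun I01 f.
Proof.
apply: open_continuous_measurable_fun; first exact: interval_open.
by move=> u; rewrite inE /= in_itv /=; exact: cf.
Qed.

(** By monotone convergence: the integral of [f] over [[cut n, 1 - cut n]] is an
    increment of [F], hence at most [2 * M]. *)
Lemma integrable_derivative (M : R) : (forall u, 0 < u < 1 -> 0 <= f u) ->
  (forall u, 0 < u < 1 -> `|F u| <= M) ->
  mu.-integrable I01 (EFin \o f).
Proof.
move=> f0 FM; apply/integrableP; split; first exact/measurable_EFinP.
have cut01 n u : cutitv n u -> 0 < u < 1.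
  by move=> h; have : (\bigcup_n cutitv n) u by [exists n];
    rewrite cutitv_bigcup /= in_itv.
have -> : (\int[mu]_(u in I01) `|(EFin \o f) u| =
    \int[mu]_(u in I01) (EFin \o f) u)%E.
  by apply: eq_integral => u; rewrite inE /= in_itv /= => h; rewrite ger0_norm// f0.
have cv : (\int[mu]_(u in cutitv n) (EFin \o f) u)%E @[n --> \oo] -->
    (\int[mu]_(u in I01) (EFin \o f) u)%E.
  rewrite -cutitv_bigcup; apply: ge0_nondecreasing_set_cvg_integral.
  - move=> m n mn; apply/subsetPset => u; rewrite /cutitv /= !in_itv /=.
    by have := cut_nonincreasing mn => h /andP[h1 h2]; apply/andP; split; lra.
  - by move=> n; exact: measurable_itv.
  - move=> n; apply/measurable_EFinP; apply: measurable_funS f_meas => //.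
    by move=> u /cut01 /=; rewrite in_itv.
  - by move=> n u /cut01 /f0; rewrite /= lee_fin.
apply: (@le_lt_trans _ _ (2 * M)%:E); last by rewrite ltry.
apply: (@cvge_to_le _ _ _ _ _ _ _ cv); apply: nearW => n /=.
rewrite FTC_cut -EFinD lee_fin.
have c0 := cut_gt0 n; have c3 := cut_le n.
have h3 : 3^-1 * 3 = 1 :> R by rewrite mulVf// pnatr_eq0.
have := FM (1 - cut n); have := FM (cut n); rewrite !ler_norml => h1 h2.
have /andP[] := h1 ltac:(lra); have /andP[] := h2 ltac:(lra); lra.
Qed.

(** The integrand may be unbounded at both ends, as for a beta integral with
    small exponents, so the classical theorem is applied on
    [[cut n, 1 - cut n]] and passed to the limit by dominated convergence. *)
Lemma FTC_oo : mu.-integrable I01 (EFin \o f) ->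
  (fun n => F (cut n)) @ \oo --> (0 : R) ->
  (fun n => F (1 - cut n)) @ \oo --> (0 : R) ->
  \int[mu]_(u in I01) f u = 0.
Proof.
move=> fi F0 F1.
have cutE n : \int[mu]_(u in I01) (f \_ (cutitv n)) u =
    F (1 - cut n) - F (cut n).
  rewrite -Rintegral_mkcondr.
  rewrite (_ : _ `&` _ = cutitv n); last first.
    by apply/setIidPr; rewrite -cutitv_bigcup; exact: bigcup_sup.
  by rewrite /Rintegral FTC_cut.
have c1 : (fun n => F (1 - cut n) - F (cut n)) @ \oo --> (0 : R).
  by rewrite -[0]subr0; exact: cvgB.
have c2 : (fun n => F (1 - cut n) - F (cut n)) @ \oo -->
    \int[mu]_(u in I01) f u.
  under eq_fun do rewrite -cutE.
  apply: (@Rintegral_dominated _ _ _ _ (fun u => `|f u|)) => //.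
  - move=> n; apply/(measurable_restrict f) => //; first exact: measurable_itv.
    exact: measurable_funS f_meas.
  - move=> u; rewrite -cutitv_bigcup => -[N _ uN].
    apply: (cvg_near_cst); exists N => // n /= Nn.
    rewrite patchE mem_set//; move: uN; rewrite /cutitv /= !in_itv /=.
    by have := cut_nonincreasing Nn => h /andP[h1 h2]; apply/andP; split; lra.
  - exact: integrable_norm.
  - move=> n u _; rewrite patchE; case: ifPn => //.
    by rewrite normr0.
exact: (cvg_unique _ c2 c1).
Qed.

End FTC.

(** * Derivatives of complex functions of a real variable *)

Section ComplexDerivative.
Variable R : realType.
Implicit Types (h : R -> R[i]) (t : R) (d c z : R[i]).

(** The derivative of a function of a real variable with values in [R[i]], taken
    componentwise so that the real differential calculus applies. *)
Definition cder h t d := is_derive t 1 (fun s => re (h s)) (re d) /\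
  is_derive t 1 (fun s => im (h s)) (im d).

Lemma cder_eq h t d d' : d = d' -> cder h t d -> cder h t d'.
Proof. by move=> ->. Qed.

Lemma cder_cst c t : cder (fun=> c) t 0.
Proof. by split; exact: is_derive_cst. Qed.

Lemma cder_real (f : R -> R) t df : is_derive t 1 f df ->
  cder (fun s => (f s)%:C) t df%:C.
Proof. by move=> df'; split => //=; exact: is_derive_cst. Qed.

Lemma cderD h1 h2 t d1 d2 : cder h1 t d1 -> cder h2 t d2 ->
  cder (fun s => h1 s + h2 s) t (d1 + d2).
Proof.
move=> [a1 b1] [a2 b2]; split.
- by under eq_fun do rewrite reD; rewrite reD; exact: is_deriveD.
- by under eq_fun do rewrite imD; rewrite imD; exact: is_deriveD.
Qed.

Lemma cderM h1 h2 t d1 d2 : cder h1 t d1 -> cder h2 t d2 ->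
  cder (fun s => h1 s * h2 s) t (d1 * h2 t + h1 t * d2).
Proof.
move=> [a1 b1] [a2 b2]; split.
- under eq_fun do rewrite reM.
  apply: (is_derive_eq (is_deriveB (is_deriveM a1 a2) (is_deriveM b1 b2))).
  by rewrite reD !reM /GRing.scale /=; ring.
- under eq_fun do rewrite imM.
  apply: (is_derive_eq (is_deriveD (is_deriveM a1 b2) (is_deriveM b1 a2))).
  by rewrite imD !imM /GRing.scale /=; ring.
Qed.

Lemma cderZ c h t d : cder h t d -> cder (fun s => c * h s) t (c * d).
Proof.
move=> hd; apply: (cder_eq _ (cderM (cder_cst c t) hd)).
by rewrite mul0r add0r.
Qed.

Lemma cder_cexp h t d : cder h t d ->
  cder (fun s => cexp (h s)) t (cexp (h t) * d).
Proof.
move=> [a b].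
have e1 := is_derive1_comp (is_derive_expR (re (h t))) a.
have s1 := is_derive1_comp (is_derive_sin (im (h t))) b.
have c1 := is_derive1_comp (is_derive_cos (im (h t))) b.
split.
- under eq_fun do rewrite cexpE.
  apply: (is_derive_eq (is_deriveM e1 c1)).
  by rewrite reM cexpE /GRing.scale /=; ring.
- under eq_fun do rewrite cexpE.
  apply: (is_derive_eq (is_deriveM e1 s1)).
  by rewrite imM cexpE /GRing.scale /=; ring.
Qed.

End ComplexDerivative.

(** * The complex exponential series *)

Section ExponentialSeries.
Variable R : realType.

Lemma is_derive_exprn N (t : R) :
  is_derive t 1 (fun s : R => s ^+ N.+1) (N.+1%:R * t ^+ N).
Proof.
rewrite (_ : (fun s => _) = id ^+ N.+1); last by apply/funext => s; rewrite fctE.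
apply: (is_derive_eq (is_deriveX _ _)).
by rewrite /GRing.scale /= mulr1.
Qed.

(** Mean value theorem applied to [c / N.+1 * t ^+ N.+1 - g t] and
    [c / N.+1 * t ^+ N.+1 + g t], which have a nonnegative derivative. *)
Lemma norm_le_of_derive_le (g dg : R -> R) (c : R) N :
  (forall t : R, is_derive t 1 g (dg t)) -> g 0 = 0 ->
  (forall t : R, 0 <= t <= 1 -> `|dg t| <= c * t ^+ N) ->
  forall t : R, 0 <= t <= 1 -> `|g t| <= c / N.+1%:R * t ^+ N.+1.
Proof.
move=> dg' g0 dgc t /andP[t0 t1].
have dX (s : R) : is_derive s 1 (fun s : R => c / N.+1%:R * s ^+ N.+1) (c * s ^+ N).
  apply: (is_derive_eq (is_deriveZ (c / N.+1%:R) (is_derive_exprn N s))).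
  by rewrite /GRing.scale /= mulrA divfK ?pnatr_eq0.
have key (e : R) : `|e| = 1 -> e * g t <= c / N.+1%:R * t ^+ N.+1.
  move=> e1.
  have dh (s : R) : is_derive s 1 (fun s : R => c / N.+1%:R * s ^+ N.+1 - e * g s)
      (c * s ^+ N - e * dg s).
    exact: (is_deriveB (dX s) (is_deriveZ e (dg' s))).
  have [|s] := MVT_segment t0 (fun s _ => dh s).
    apply: derivable_within_continuous => s _.
    by have [] := dh s.
  rewrite in_itv /= => /andP[s0 st]; rewrite g0 mulr0 expr0n mulr0 !subr0.
  move=> E; rewrite -subr_ge0 {}E mulr_ge0// subr_ge0.
  rewrite (le_trans (ler_norm _))// normrM e1 mul1r dgc// s0 /=.
  exact: le_trans st t1.
rewrite ler_norml; apply/andP; split; last first.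
  by have := key 1; rewrite normr1 mul1r; apply.
by have := key (-1); rewrite normrN1 => /(_ erefl); rewrite mulN1r lerNl.
Qed.

Variable z : R[i].

Let partial (N : nat) (t : R) : R[i] :=
  \sum_(0 <= n < N) t%:C ^+ n * (z ^+ n / n`!%:R).

Let cder_partial N t : cder (partial N.+1) t (z * partial N t).
Proof.
elim: N => [|N ih].
  rewrite /partial big_geq// mulr0.
  under [X in cder X _ _]eq_fun do rewrite big_nat1 expr0 mul1r.
  exact: cder_cst.
rewrite (_ : partial N.+2 = fun s => partial N.+1 s +
  (z ^+ N.+1 / N.+1`!%:R) * (s ^+ N.+1)%:C); last first.
  by apply/funext => s; rewrite /partial big_nat_recr//= mulrC rmorphXn.
have dX := is_derive_exprn N t.
apply: (cder_eq _ (cderD ih (cderZ _ (cder_real dX)))).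
rewrite /partial [in RHS]big_nat_recr//= mulrDr; congr (_ + _).
rewrite rmorphM rmorph_nat rmorphXn /= factS natrM exprS.
have n0 : (N.+1%:R : R[i]) != 0 by rewrite pnatr_eq0.
have f0 : (N`!%:R : R[i]) != 0 by rewrite pnatr_eq0 -lt0n fact_gt0.
move: (N.+1%:R : R[i]) (N`!%:R : R[i]) n0 f0 => x y x0 y0.
by field; rewrite x0 y0.
Qed.

Let rest N t := cexp (t%:C * z) - partial N t.

Let cder_rest N t : cder (rest N.+1) t (z * rest N t).
Proof.
have dt : cder (fun s : R => s%:C * z) t z.
  have /cder_real d1 := is_derive_id t (1 : R).
  by apply: (cder_eq _ (cderM d1 (cder_cst z t))); rewrite mulr0 addr0 mul1r.
rewrite /rest; under [X in cder X _ _]eq_fun do rewrite -[- _]mulN1r.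
apply: (cder_eq _ (cderD (cder_cexp dt) (cderZ _ (cder_partial N t)))).
by ring.
Qed.

Let rest0 N : rest N.+1 0 = 0.
Proof.
rewrite /rest /partial rmorph0 mul0r cexp0 big_nat_recl//= big1_seq ?addr0.
  by rewrite !expr0 fact0 divr1 mul1r subrr.
by move=> i _; rewrite exprS mul0r mul0r.
Qed.

Let L := 2 * nm z.
Let K := expR `|re z|.

Let L0 : 0 <= L. Proof. by rewrite mulr_ge0// nm_ge0. Qed.

Let rest_le N t : 0 <= t <= 1 ->
  `|re (rest N t)| <= K * L ^+ N / N`!%:R * t ^+ N /\
  `|im (rest N t)| <= K * L ^+ N / N`!%:R * t ^+ N.
Proof.
elim: N t => [|N ih] t t01.
  have : nm (rest 0 t) <= K.
    rewrite /rest /partial big_geq// subr0 nm_cexp ler_expR reM /= mul0r subr0.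
    rewrite (le_trans (ler_norm _))// normrM; case/andP: t01 => t0 t1.
    by rewrite ger0_norm// ler_piMl.
  rewrite !expr0 fact0 divr1 !mulr1 => h.
  by split; [exact: le_trans (le_re_nm _) h|exact: le_trans (le_im_nm _) h].
have b s : 0 <= s <= 1 -> nm (z * rest N s) <=
    K * L ^+ N.+1 / N`!%:R * s ^+ N.
  move=> /ih[h1 h2]; rewrite nmM (le_trans (ler_wpM2l (nm_ge0 z) (nm_le_reim _)))//.
  apply: (le_trans (ler_wpM2l (nm_ge0 z) (lerD h1 h2))).
  rewrite le_eqVlt; apply/orP; left; apply/eqP.
  rewrite exprS (_ : L * L ^+ N = 2 * nm z * L ^+ N)//.
  by move: (L ^+ N) (N`!%:R^-1) => x y; ring.
have E : K * L ^+ N.+1 / N.+1`!%:R = (K * L ^+ N.+1 / N`!%:R) / N.+1%:R.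
  by rewrite factS natrM invfM [N.+1%:R^-1 * _]mulrC mulrA.
rewrite E; split.
- apply: (norm_le_of_derive_le (fun s => (cder_rest N s).1)) => //.
    by rewrite rest0.
  by move=> s /b; apply: le_trans; exact: le_re_nm.
- apply: (norm_le_of_derive_le (fun s => (cder_rest N s).2)) => //.
    by rewrite rest0.
  by move=> s /b; apply: le_trans; exact: le_im_nm.
Qed.

(** [cexp] is defined by its polar form. The remainder of the series at [t z]
    vanishes at [t = 0] and its derivative is [z] times the previous remainder,
    so integrating [N] times from [0] bounds it by [(2 |z|) ^ N / N!]. *)
Lemma cvg_series_cexp :
  series ((fun n => z ^+ n / n`!%:R) : nat -> R[i]^o) @ \oo --> (cexp z : R[i]^o).
Proof.
apply/cvg_nmP.
have c0 : (fun n => 2 * K * exp_coeff L n) @ \oo --> (0 : R).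
  by rewrite -[0](mulr0 (2 * K)); apply: cvgMr; exact: cvg_exp_coeff.
apply: (cvg0_le _ c0) => n; rewrite nm_ge0 /=.
have E : series ((fun n => z ^+ n / n`!%:R) : nat -> R[i]^o) n = partial n 1.
  by rewrite /series /partial /=; apply: eq_bigr => i _; rewrite expr1n mul1r.
have [|h1 h2] := @rest_le n 1; first by rewrite ler01 lexx.
rewrite E nm_sub (_ : cexp z = cexp (1%:C * z)); last by rewrite mul1r.
rewrite (le_trans (nm_le_reim _))// (le_trans (lerD h1 h2))//.
rewrite expr1n mulr1 /exp_coeff /= le_eqVlt; apply/orP; left; apply/eqP.
ring.
Qed.

End ExponentialSeries.

(** * Euler's beta integral *)

Section Beta.
Variable R : realType.
Local Notation mu := (@lebesgue_measure R).
Local Notation I01 := (`]0, 1[%classic : set R).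
Implicit Types (a c : R[i]) (A C u : R).

Lemma I01P u : I01 u -> 0 < u < 1.
Proof. by rewrite /= in_itv. Qed.

Lemma cder_continuous (h : R -> R[i]) u d : cder h u d ->
  {for u, continuous (fun s => re (h s))} /\
  {for u, continuous (fun s => im (h s))}.
Proof.
move=> [[d1 _] [d2 _]]; split; apply: differentiable_continuous;
by rewrite -derivable1_diffP.
Qed.

Lemma powR_le1 u A : 0 < u < 1 -> 0 <= A -> u `^ A <= 1.
Proof.
move=> /andP[u0 u1] A0; rewrite -(powRr0 u).
by apply: ger_powR => //; rewrite u0 ltW.
Qed.

(** [u ^ (A - 1)] is the derivative of [u ^ A / A], which is bounded on the unit
    interval. *)
Lemma integrable_powR A : 0 < A -> mu.-integrable I01 (EFin \o (fun u => u `^ (A - 1))).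
Proof.
move=> A0; apply: (@integrable_derivative _ (fun u => A^-1 * u `^ A) _ _ _ A^-1).
- move=> u /andP[u0 u1].
  apply: (is_derive_eq (is_deriveZ A^-1 (is_derive1_powR A u0))).
  by rewrite /GRing.scale /= mulrA mulVf ?mul1r// gt_eqF.
- move=> u /andP[u0 u1].
  have [d _] := is_derive1_powR (A - 1) u0.
  by apply: differentiable_continuous; rewrite -derivable1_diffP.
- by move=> u _; exact: powR_ge0.
- move=> u u01; have A0' : 0 <= A^-1 by rewrite invr_ge0 ltW.
  rewrite ger0_norm; last by rewrite mulr_ge0 ?powR_ge0.
  by rewrite ler_piMr// powR_le1// ltW.
Qed.

Lemma preimage_onem : (fun u : R => 1 + (-1) * u) @^-1` I01 = I01.
Proof.
by apply/seteqP; split=> u /=; rewrite !in_itv /= => /andP[h1 h2]; lra.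
Qed.

Lemma integrable_onem (f : R -> R) : mu.-integrable I01 (EFin \o f) ->
  mu.-integrable I01 (EFin \o (fun u => f (1 - u))).
Proof.
have k0 : (-1 : R) != 0 by rewrite oppr_eq0 oner_eq0.
move=> /(integrable_affine 1 k0 (measurable_itv _)); rewrite preimage_onem.
by apply: eq_integrable => // u _ /=; rewrite mulN1r.
Qed.

Lemma powR_half_le A u : 2^-1 <= u <= 1 -> u `^ A <= 1 + 2^-1 `^ A.
Proof.
move=> /andP[u2 u1].
have h0 : 0 < 2^-1 :> R by rewrite invr_gt0.
have u0 : 0 < u := lt_le_trans h0 u2.
have [A0|A0] := lerP 0 A.
  apply: (@le_trans _ _ 1); last by rewrite lerDl powR_ge0.
  by rewrite -(powRr0 u) ger_powR// u0.
apply: (@le_trans _ _ (2^-1 `^ A)); last by rewrite lerDr.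
rewrite -[A]opprK !(powRN _ (- A)) lef_pV2 ?posrE ?powR_gt0//.
by apply: ge0_ler_powR; rewrite ?nnegrE ?oppr_ge0 ?(ltW A0) ?(ltW h0) ?(ltW u0).
Qed.

Lemma measurable_powRf D (f : R -> R) A : measurable_fun D f ->
  measurable_fun D (fun u => f u `^ A).
Proof. by move=> mf; exact: (measurableT_comp (measurable_powR A) mf). Qed.

Lemma measurable_onem D : measurable_fun D (fun u : R => 1 - u).
Proof. by apply: measurable_funB; [exact: measurable_cst|exact: measurable_id]. Qed.

(** On each half of the interval one of the two factors is bounded. *)
Lemma integrable_beta A C : 0 < A -> 0 < C ->
  mu.-integrable I01 (EFin \o (fun u => u `^ (A - 1) * (1 - u) `^ (C - 1))).
Proof.
move=> A0 C0.
pose K := 1 + 2^-1 `^ (C - 1) : R; pose L := 1 + 2^-1 `^ (A - 1) : R.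
have K0 : 0 <= K by rewrite addr_ge0 ?powR_ge0.
have L0 : 0 <= L by rewrite addr_ge0 ?powR_ge0.
have i1 := integrable_EFinZ K (measurable_itv _) (integrable_powR A0).
have i2 := integrable_EFinZ L (measurable_itv _)
  (integrable_onem (integrable_powR C0)).
have := integrable_EFinD (measurable_itv _) i1 i2.
apply: le_integrable => //.
  apply/measurable_EFinP; apply: measurable_funM.
    exact: measurable_powRf.
  by apply: measurable_powRf; exact: measurable_onem.
move=> u /I01P/andP[u0 u1] /=; rewrite lee_fin.
rewrite ger0_norm ?mulr_ge0 ?powR_ge0// ger0_norm; last first.
  by rewrite addr_ge0 ?mulr_ge0 ?powR_ge0.
have [h|h] := lerP u 2^-1.
  rewrite (@le_trans _ _ (K * u `^ (A - 1)))//; last first.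
    by rewrite lerDl mulr_ge0 ?powR_ge0.
  rewrite mulrC ler_wpM2r ?powR_ge0// powR_half_le//.
  have : 2^-1 * 2 = 1 :> R by rewrite mulVf ?pnatr_eq0.
  by move=> ?; apply/andP; split; lra.
rewrite (@le_trans _ _ (L * (1 - u) `^ (C - 1)))//; last first.
  by rewrite lerDr mulr_ge0 ?powR_ge0.
by rewrite ler_wpM2r ?powR_ge0// powR_half_le// !ltW.
Qed.

Definition bkernel a c u := cpow u%:C (a - 1) * cpow (1 - u)%:C (c - 1).

Lemma nm_bkernel a c u : 0 < u < 1 ->
  nm (bkernel a c u) = u `^ (re a - 1) * (1 - u) `^ (re c - 1).
Proof.
move=> /andP[u0 u1]; rewrite nmM !nm_cpow_pos ?subr_gt0//.
by rewrite !reB.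
Qed.

Lemma cmeas_bkernel a c : cmeas I01 (bkernel a c).
Proof.
apply: cmeasM.
- by apply: cmeas_cpow => // u /I01P/andP[].
- apply: (@cmeas_cpow _ _ (fun u => 1 - u)); last exact: measurable_onem.
  by move=> u /I01P/andP[u0 u1]; rewrite subr_gt0.
Qed.

Lemma cinteg_bkernel a c : 0 < re a -> 0 < re c -> cinteg I01 (bkernel a c).
Proof.
move=> a0 c0; apply: (cinteg_le _ _ (integrable_beta a0 c0)) => //.
- exact: cmeas_bkernel.
- by move=> u /I01P/nm_bkernel ->.
Qed.

Lemma bkernelDl a c u : 0 < u < 1 -> bkernel (a + 1) c u = u%:C * bkernel a c u.
Proof.
move=> /andP[u0 u1]; rewrite /bkernel (_ : a + 1 - 1 = (a - 1) + 1); last by ring.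
rewrite (cpow_posD (a - 1) 1 u0) cpow_pos1//; ring.
Qed.

Lemma bkernelDr a c u : 0 < u < 1 ->
  bkernel a (c + 1) u = (1 - u)%:C * bkernel a c u.
Proof.
move=> /andP[u0 u1]; have u1' : 0 < 1 - u by rewrite subr_gt0.
rewrite /bkernel (_ : c + 1 - 1 = (c - 1) + 1); last by ring.
rewrite (cpow_posD (c - 1) 1 u1') cpow_pos1//; ring.
Qed.

Lemma cBetaE a c : cBeta a c = cintegral I01 (bkernel a c).
Proof. by []. Qed.

Lemma re_gt0D1 a : 0 < re a -> 0 < re (a + 1).
Proof. by move=> a0; rewrite reD /=; lra. Qed.

Lemma cBeta_split a c : 0 < re a -> 0 < re c ->
  cBeta a c = cBeta (a + 1) c + cBeta a (c + 1).
Proof.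
move=> a0 c0; rewrite !cBetaE -cintegralD//; last 2 first.
- by apply: cinteg_bkernel => //; exact: re_gt0D1.
- by apply: cinteg_bkernel => //; exact: re_gt0D1.
apply: eq_cintegral => u /I01P u01.
by rewrite bkernelDl// bkernelDr// -mulrDl -rmorphD /= addrCA subrr addr0 mul1r.
Qed.

Lemma is_derive_onem u : is_derive u 1 (fun s : R => 1 - s) (-1).
Proof.
have := is_deriveB (is_derive_cst (1 : R) u (1 : R)) (is_derive_id u (1 : R)).
by rewrite sub0r.
Qed.

(** [u ^ a (1 - u) ^ c], written with [cexp] and [ln] so that the chain rule
    applies directly. *)
Definition beta_prim a c u : R[i] := cexp (a * (ln u)%:C + c * (ln (1 - u))%:C).

Let dbeta_prim a c u : R[i] := beta_prim a c u * (a * u^-1%:C + c * (- (1 - u)^-1)%:C).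

Lemma beta_primE a c u : 0 < u < 1 -> beta_prim a c u = cpow u%:C a * cpow (1 - u)%:C c.
Proof. by move=> /andP[u0 u1]; rewrite /beta_prim !cpow_pos ?subr_gt0// -cexpD. Qed.

Let cder_lin a c u : 0 < u < 1 ->
  cder (fun s => a * (ln s)%:C + c * (ln (1 - s))%:C) u
   (a * u^-1%:C + c * (- (1 - u)^-1)%:C).
Proof.
move=> /andP[u0 u1].
have u1' : 0 < 1 - u by rewrite subr_gt0.
have d1 := is_derive_onem u.
have d2 : is_derive u 1 (fun s : R => ln (1 - s)) (- (1 - u)^-1).
  apply: (is_derive_eq (@is_derive1_comp _ (@ln R) (fun s => 1 - s) u _ _
    (is_derive1_ln u1') d1)).
  by rewrite mulrN1.
apply: cderD; apply: cderZ; apply: cder_real => //.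
exact: is_derive1_ln.
Qed.

Lemma cder_beta_prim a c u : 0 < u < 1 -> cder (beta_prim a c) u (dbeta_prim a c u).
Proof. by move=> u01; apply: cder_cexp; exact: cder_lin. Qed.

Let continuous_dbeta_prim a c u : 0 < u < 1 ->
  {for u, continuous (fun s => re (dbeta_prim a c s))} /\
  {for u, continuous (fun s => im (dbeta_prim a c s))}.
Proof.
move=> u01; have /andP[u0 u1] := u01.
have u1' : 1 - u != 0 by rewrite gt_eqF// subr_gt0.
have d1 := is_derive_onem u.
have v1 := is_deriveV (lt0r_neq0 u0) (is_derive_id u (1:R)).
have v2 := is_deriveN (@is_deriveV _ (fun s => 1 - s) u _ _ u1' d1).
have e := cderD (cderZ a (cder_real v1)) (cderZ c (cder_real v2)).
exact: cder_continuous (cderM (cder_beta_prim a c u01) e).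
Qed.

(** The derivative of [u ^ a (1 - u) ^ c] combines two beta densities; its
    integral vanishes since [u ^ a (1 - u) ^ c] is [0] at both ends. *)
Let dbeta_primE a c u : 0 < u < 1 ->
  dbeta_prim a c u = a * bkernel a (c + 1) u + (- c) * bkernel (a + 1) c u.
Proof.
move=> u01; have /andP[u0 u1] := u01; rewrite /dbeta_prim beta_primE//.
rewrite /bkernel !addrK.
have u1' : 0 < 1 - u by rewrite subr_gt0.
have sub1 (t : R) s : 0 < t -> cpow t%:C s = t%:C * cpow t%:C (s - 1).
  move=> t0; rewrite {1}(_ : s = (s - 1) + 1); last by ring.
  by rewrite (cpow_posD (s - 1) 1 t0) cpow_pos1// mulrC.
rewrite (sub1 _ a u0) (sub1 _ c u1').
have U0 : u%:C != 0 by rewrite -nm_gt0 nmR normr_gt0 gt_eqF.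
have U1 : (1 - u)%:C != 0 by rewrite -nm_gt0 nmR normr_gt0 gt_eqF// subr_gt0.
have -> : u^-1%:C = (u%:C)^-1 by exact: fmorphV.
have -> : (- (1 - u)^-1)%:C = - ((1 - u)%:C)^-1.
  by rewrite rmorphN; congr (- _); exact: fmorphV.
move: (u%:C) ((1 - u)%:C) U0 U1 => x y x0 y0.
by field; rewrite x0 y0.
Qed.

Let nm_beta_prim_le a c u : 0 < u < 1 -> 0 < re a -> 0 < re c ->
  nm (beta_prim a c u) <= u `^ re a /\ nm (beta_prim a c u) <= (1 - u) `^ re c.
Proof.
move=> u01 a0 c0; have /andP[u0 u1] := u01.
rewrite beta_primE// nmM !nm_cpow_pos ?subr_gt0//; split.
- by rewrite ler_piMr ?powR_ge0// powR_le1 ?ltW//; lra.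
- by rewrite ler_piMl ?powR_ge0// powR_le1// ltW.
Qed.

Let cvg_cut_powR A : 0 < A -> (fun n => cut R n `^ A) @ \oo --> (0 : R).
Proof.
move=> A0; have /cvg_at_rightP h := @powR_cvg0 R A A0.
by apply: h; split; [exact: cut_gt0|exact: cvg_cut].
Qed.

(** Integration by parts. *)
Lemma cBeta_shift a c : 0 < re a -> 0 < re c ->
  a * cBeta a (c + 1) = c * cBeta (a + 1) c.
Proof.
move=> a0 c0.
have i1 := cinteg_bkernel a0 (re_gt0D1 c0).
have i2 := cinteg_bkernel (re_gt0D1 a0) c0.
have mI : measurable I01 by exact: measurable_itv.
have id : cinteg I01 (dbeta_prim a c).
  apply: eq_cinteg (cintegD mI (cintegZ a mI i1) (cintegZ (- c) mI i2)) => //.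
  by move=> u /I01P u01; rewrite dbeta_primE.
have cut01 n : 0 < cut R n < 1.
  have := cut_le R n; rewrite cut_gt0 /=.
  have : 3^-1 * 3 = 1 :> R by rewrite mulVf ?pnatr_eq0.
  lra.
have cut01' n : 0 < 1 - cut R n < 1 by have := cut01 n; lra.
have c1 := cvg_cut_powR a0; have c2 := cvg_cut_powR c0.
have b1 n : nm (beta_prim a c (cut R n)) <= cut R n `^ re a.
  by have [] := nm_beta_prim_le (cut01 n) a0 c0.
have b2 n : nm (beta_prim a c (1 - cut R n)) <= cut R n `^ re c.
  have [_] := nm_beta_prim_le (cut01' n) a0 c0.
  by rewrite opprB addrCA subrr addr0.
have z0 (g : R[i] -> R) (h : nat -> R[i]) (b : nat -> R) :
    (forall z, `|g z| <= nm z) -> (forall n, nm (h n) <= b n) ->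
    b @ \oo --> (0 : R) -> (fun n => g (h n)) @ \oo --> (0 : R).
  move=> gn hb b0; apply/norm_cvg0P; apply: (cvg0_le _ b0) => n.
  by rewrite normr_ge0 /= (le_trans (gn _)).
have E : cintegral I01 (dbeta_prim a c) = 0.
  apply/eqP; rewrite eq_complex /=; apply/andP; split; apply/eqP.
  - apply: (@FTC_oo _ (fun u => re (beta_prim a c u))).
    + by move=> u u01; have [] := cder_beta_prim a c u01.
    + by move=> u u01; have [] := continuous_dbeta_prim a c u01.
    + by case: id.
    + exact: (z0 _ _ _ (@le_re_nm R) b1 c1).
    + exact: (z0 _ _ _ (@le_re_nm R) b2 c2).
  - apply: (@FTC_oo _ (fun u => im (beta_prim a c u))).
    + by move=> u u01; have [] := cder_beta_prim a c u01.
    + by move=> u u01; have [] := continuous_dbeta_prim a c u01.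
    + by case: id.
    + exact: (z0 _ _ _ (@le_im_nm R) b1 c1).
    + exact: (z0 _ _ _ (@le_im_nm R) b2 c2).
move: E; rewrite (eq_cintegral (h2 := fun u => a * bkernel a (c + 1) u +
    (- c) * bkernel (a + 1) c u)); last by move=> u /I01P; exact: dbeta_primE.
rewrite cintegralD//; try exact: cintegZ.
rewrite !cintegralZ// -!cBetaE => /eqP.
by rewrite mulNr subr_eq0 => /eqP.
Qed.

Lemma cBetaDl a c : 0 < re a -> 0 < re c ->
  (a + c) * cBeta (a + 1) c = a * cBeta a c.
Proof.
move=> a0 c0; rewrite (cBeta_split a0 c0) mulrDr cBeta_shift//; ring.
Qed.

Lemma cBetaDr a c : 0 < re a -> 0 < re c ->
  (a + c) * cBeta a (c + 1) = c * cBeta a c.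
Proof.
move=> a0 c0; rewrite (cBeta_split a0 c0) mulrDr -cBeta_shift//; ring.
Qed.

End Beta.

(** * The beta function has no zeros *)

Section BetaNonzero.
Variable R : realType.
Local Notation mu := (@lebesgue_measure R).
Local Notation I01 := (`]0, 1[%classic : set R).
Implicit Types (a b c d : R[i]) (u : R).

Lemma cBeta_eq0_shift a c n : 0 < re a -> 0 < re c -> cBeta a c = 0 ->
  cBeta (a + n%:R) (c + n%:R) = 0.
Proof.
move=> a0 c0 B0.
have pos b (k : nat) : 0 < re b -> 0 < re (b + k%:R).
  by move=> b0; rewrite reD re_nat ltr_wpDr.
have nz b d : 0 < re b -> 0 < re d -> b + d != 0.
  move=> b0 d0; apply/eqP => E; have : re (b + d) = 0 by rewrite E.
  by rewrite reD; lra.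
elim: n => [|n ih]; first by rewrite !addr0.
have an := pos a n a0; have cn := pos c n c0.
rewrite -!natr1 !addrA.
have Ba : cBeta (a + n%:R + 1) (c + n%:R) = 0.
  apply: (mulfI (nz _ _ an cn)); rewrite mulr0.
  by rewrite cBetaDl// ih mulr0.
apply: (mulfI (nz _ _ (re_gt0D1 an) cn)); rewrite mulr0.
by rewrite cBetaDr ?re_gt0D1// Ba mulr0.
Qed.

Lemma bkernel_shift a c n u : 0 < u < 1 ->
  bkernel (a + n%:R) (c + n%:R) u = (u * (1 - u))%:C ^+ n * bkernel a c u.
Proof.
move=> u01; elim: n => [|n ih]; first by rewrite !addr0 expr0 mul1r.
rewrite -!natr1 !addrA bkernelDl// bkernelDr// ih exprS rmorphM; ring.
Qed.

Lemma expr_ratio_lt (x y M d : R) : 0 <= x < y -> 0 < d ->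
  exists n, M * x ^+ n < d * y ^+ n.
Proof.
move=> /andP[x0 xy] d0; have y0 : 0 < y := le_lt_trans x0 xy.
have q : `|x / y| < 1.
  by rewrite ger0_norm ?divr_ge0// ?ltW// ltr_pdivrMr// mul1r.
have c0 : (fun n => M * (x / y) ^+ n) @ \oo --> (0 : R).
  by rewrite -[0](mulr0 M); apply: cvgMr; exact: cvg_expr.
have [n _ /(_ n (leqnn n)) /= h] := cvgr_lt _ c0 _ d0.
exists n; move: h; rewrite exprMn exprVn mulrA ltr_pdivrMr// exprn_gt0//.
Qed.

(** [4 u (1 - u) = 1 - 4 (u - 1/2) ^ 2] is at least [1 - d ^ 2] where
    [|u - 1/2| <= d / 2] and at most [1 - 4 d ^ 2] where [|u - 1/2| >= d]; in
    between the integrand is positive and may be dropped. *)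
Lemma peak_lower_bound (d u r N : R) n : 0 < u < 1 -> 0 < d <= 4^-1 ->
  (`|u - 2^-1| < d -> 2^-1 < r) -> `|r| <= N ->
  (1 - d ^+ 2) ^+ n / 2 * (`|u - 2^-1| <= d / 2)%R%:R - (1 - 4 * d ^+ 2) ^+ n * N
  <= (4 * (u * (1 - u))) ^+ n * r.
Proof.
move=> /andP[u0 u1] /andP[d0 d4] ur rN.
have N0 : 0 <= N by apply: le_trans rN.
have h4 : 4^-1 * 4 = 1 :> R by rewrite mulVf ?pnatr_eq0.
have d1 : d ^+ 2 <= 4^-1 by rewrite expr2; nra.
have b0 : 0 <= 1 - 4 * d ^+ 2 by lra.
have c0 : 0 <= 1 - d ^+ 2 by lra.
have gE : 4 * (u * (1 - u)) = 1 - 4 * (u - 2^-1) ^+ 2 by field.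
have g0 : 0 <= 4 * (u * (1 - u)).
  by rewrite mulr_ge0 ?ler0n// mulr_ge0 ?subr_ge0 ?(ltW u0) ?(ltW u1).
have q0 : 0 <= (1 - 4 * d ^+ 2) ^+ n * N by rewrite mulr_ge0 ?exprn_ge0.
have sq (t : R) : 0 <= t -> `|u - 2^-1| <= t -> (u - 2^-1) ^+ 2 <= t ^+ 2.
  move=> t0 ut; rewrite -real_normK ?num_real//.
  by apply: lerXn2r => //; rewrite nnegrE.
have [uJ|uJ] := lerP `|u - 2^-1| (d / 2).
  have rh : 2^-1 < r by apply: ur; lra.
  have gn : (1 - d ^+ 2) ^+ n <= (4 * (u * (1 - u))) ^+ n.
    apply: lerXn2r; rewrite ?nnegrE// gE lerD2l lerN2.
    have := sq _ (divr_ge0 (ltW d0) (ler0n R 2)) uJ.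
    by rewrite exprMn => h; lra.
  have p0 : 0 <= (1 - d ^+ 2) ^+ n by rewrite exprn_ge0.
  rewrite mulr1; apply: (@le_trans _ _ ((1 - d ^+ 2) ^+ n * 2^-1)).
    by rewrite lerBlDr lerDl.
  by apply: ler_pM => //; lra.
rewrite mulr0 add0r.
have [ud|ud] := ltrP `|u - 2^-1| d.
  apply: (@le_trans _ _ 0); first by rewrite oppr_le0.
  by rewrite mulr_ge0 ?exprn_ge0//; have := ur ud; lra.
have gn : (4 * (u * (1 - u))) ^+ n <= (1 - 4 * d ^+ 2) ^+ n.
  apply: lerXn2r; rewrite ?nnegrE// gE lerD2l lerN2 ler_pM2l//.
  rewrite -[leRHS]real_normK ?num_real//.
  by apply: lerXn2r; rewrite ?nnegrE// ltW.
apply: (@le_trans _ _ (- ((4 * (u * (1 - u))) ^+ n * N))).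
  by rewrite lerN2 ler_wpM2r.
rewrite -mulrN ler_wpM2l ?exprn_ge0//.
by move: rN; rewrite ler_norml => /andP[].
Qed.

(** If the integral vanished, so would every integral of [(u (1 - u)) ^+ n]
    against the same density; for large [n] these weights concentrate at the
    midpoint, near which the phase of the density is almost constant. *)
Lemma cBeta_neq0 a c : 0 < re a -> 0 < re c -> cBeta a c != 0.
Proof.
move=> a0 c0; apply/eqP => B0.
have mI : measurable I01 by exact: measurable_itv.
have h2 : 2^-1 * 2 = 1 :> R by rewrite mulVf ?pnatr_eq0.
have half01 : 0 < (2^-1 : R) < 1 by rewrite invr_gt0; lra.
(* [rho] is the density normalized to be [1] at the midpoint. *)
pose k := (bkernel a c 2^-1)^-1.
pose rho u := k * bkernel a c u.
have k0 : bkernel a c 2^-1 != 0.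
  by rewrite /bkernel mulf_neq0// cpow_neq0//; lra.
have irho : cinteg I01 rho by apply: cintegZ => //; exact: cinteg_bkernel.
have gle u : 0 <= u <= 1 -> 0 <= 4 * (u * (1 - u)) <= 1.
  move=> /andP[u0 u1]; apply/andP; split.
    by rewrite mulr_ge0 ?ler0n// mulr_ge0 ?subr_ge0.
  have := sqr_ge0 (2 * u - 1); rewrite expr2; lra.
have mg n : measurable_fun I01 (fun u => (4 * (u * (1 - u))) ^+ n).
  apply: measurable_funX; apply: measurable_funM; first exact: measurable_cst.
  by apply: measurable_funM => //; exact: measurable_onem.
have ig n : mu.-integrable I01 (EFin \o (fun u => (4 * (u * (1 - u))) ^+ n * re (rho u))).
  apply: le_integrable irho.1 => //.
    apply/measurable_EFinP; have [mr _] := cinteg_cmeas irho.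
    exact: (measurable_funM (mg n) mr).
  move=> u /I01P u01 /=; rewrite lee_fin normrM ler_piMl//.
  have /andP[g0 g1] := gle u ltac:(lra).
  by rewrite ger0_norm ?exprn_ge0// exprn_ile1.
have zero n : \int[mu]_(u in I01) ((4 * (u * (1 - u))) ^+ n * re (rho u)) = 0.
  have E : cintegral I01 (fun u => (4%:R ^+ n * k) * bkernel (a + n%:R) (c + n%:R) u) = 0.
    rewrite cintegralZ//; last by apply: cinteg_bkernel; rewrite reD re_nat ltr_wpDr.
    by rewrite -cBetaE cBeta_eq0_shift// mulr0.
  have := congr1 (@complex.Re R) E; rewrite /=; apply: etrans; apply: eq_Rintegral.
  move=> u /set_mem/I01P u01; rewrite bkernel_shift//.
  have -> : 4%:R ^+ n * k * ((u * (1 - u))%:C ^+ n * bkernel a c u) =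
      ((4 * (u * (1 - u))) ^+ n)%:C * rho u.
    have E4 : (4 : R)%:C = 4 :> R[i] by exact: (rmorph_nat (real_complex R) 4).
    have -> : ((4 * (u * (1 - u))) ^+ n)%:C = (4 * (u * (1 - u))%:C) ^+ n :> R[i].
      by rewrite -E4 -rmorphM -rmorphXn.
    by rewrite exprMn /rho; ring.
  by rewrite [RHS]reM /= mul0r subr0.
have cont : {for 2^-1, continuous (fun u => re (k * beta_prim (a - 1) (c - 1) u))}.
  exact: (cder_continuous (cderZ k (cder_beta_prim (a - 1) (c - 1) half01))).1.
have r1 : 2^-1 < re (k * beta_prim (a - 1) (c - 1) 2^-1).
  by rewrite beta_primE// mulVf//=; lra.
have [e /= e0 He] := (nbhs_ballP _ _).1 (cvgr_gt _ cont _ r1).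
(* The bound [1/4] makes both rates [1 - d ^ 2] and [1 - 4 * d ^ 2] positive. *)
pose d := Num.min e 4^-1.
have h4 : 4^-1 * 4 = 1 :> R by rewrite mulVf ?pnatr_eq0.
have d0 : 0 < d by rewrite lt_min e0 /= invr_gt0 ltr0n.
have d4 : d <= 4^-1 by rewrite ge_min lexx orbT.
have rho_half u : `|u - 2^-1| < d -> 2^-1 < re (rho u).
  move=> ud; have := He u; rewrite /= /ball /= distrC => /(_ _).
  rewrite /rho -[bkernel a c u]beta_primE => [|]; last first.
    by move: ud; rewrite ltr_norml; lra.
  by apply; apply: (lt_le_trans ud); rewrite ge_min lexx.
pose J : set R := `[2^-1 - d / 2, 2^-1 + d / 2]%classic.
have mJ : measurable J by exact: measurable_itv.
have JI : J `<=` I01.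
  by move=> u; rewrite /J /= !in_itv /= => /andP[? ?]; apply/andP; split; lra.
pose psi n u := (1 - d ^+ 2) ^+ n / 2 * \1_J u - (1 - 4 * d ^+ 2) ^+ n * nm (rho u).
have iJ : mu.-integrable I01 (EFin \o (\1_J : R -> R)).
  apply: (integrableS (E := setT)) => //; exact: integrable_indic_itv.
have inm : mu.-integrable I01 (EFin \o (fun u => nm (rho u))).
  have := integrable_EFinZ (nm k) mI (integrable_beta a0 c0).
  by apply: eq_integrable => // u /set_mem/I01P u01; rewrite /= nmM nm_bkernel.
have muJ : mu `[2^-1 - d / 2, 2^-1 + d / 2]%classic = d%:E.
  rewrite lebesgue_measure_itv /= lte_fin ifT; last by lra.
  by rewrite -EFinD; congr EFin; lra.
have intJ : \int[mu]_(u in I01) \1_J u = d.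
  by rewrite /Rintegral integral_indic// setIidl//; exact: (congr1 fine muJ).
pose C := \int[mu]_(u in I01) nm (rho u).
have ipsi n : \int[mu]_(u in I01) psi n u =
    (1 - d ^+ 2) ^+ n / 2 * d - (1 - 4 * d ^+ 2) ^+ n * C.
  rewrite RintegralB//; try exact: integrable_EFinZ.
  by rewrite !RintegralZl// intJ.
have psi_le n u : I01 u -> psi n u <= (4 * (u * (1 - u))) ^+ n * re (rho u).
  move=> /I01P u01; rewrite /psi indicE.
  rewrite (_ : (u \in J) = (`|u - 2^-1| <= d / 2)); last first.
    by rewrite ler_distl; apply/idP/idP; rewrite inE /J /= in_itv.
  apply: peak_lower_bound => //; [by rewrite d0 d4|exact: rho_half|].
  exact: le_re_nm.
have d16 : d ^+ 2 <= 4^-1 * 4^-1.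
  by rewrite expr2 ler_pM// ltW.
have [|n hn] := @expr_ratio_lt (1 - 4 * d ^+ 2) (1 - d ^+ 2) C (d / 2) _
    (divr_gt0 d0 (ltr0n R 2)).
  have : 0 < d ^+ 2 by rewrite exprn_gt0.
  by move=> ?; apply/andP; split; lra.
have jpsi : mu.-integrable I01 (EFin \o psi n).
  have i1 := integrable_EFinZ ((1 - d ^+ 2) ^+ n / 2) mI iJ.
  have i2 := integrable_EFinZ (- (1 - 4 * d ^+ 2) ^+ n) mI inm.
  have := integrable_EFinD mI i1 i2.
  by apply: eq_integrable => // u _; rewrite /= /psi mulNr.
have := le_Rintegral _ jpsi (ig n) (@psi_le n); rewrite zero ipsi => /(_ mI).
by move: hn; clear; lra.
Qed.

End BetaNonzero.

(** * The contiguous relation for Kummer's function *)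

Section Pochhammer.
Variable R : realType.
Implicit Types (a b z : R[i]).

Lemma poch0 a : poch a 0 = 1.
Proof. by rewrite /poch big_ord0. Qed.

Lemma pochS a n : poch a n.+1 = poch a n * (a + n%:R).
Proof. by rewrite /poch big_ord_recr. Qed.

Lemma pochSl a n : poch a n.+1 = a * poch (a + 1) n.
Proof.
rewrite /poch big_ord_recl addr0; congr (_ * _).
by apply: eq_bigr => i _; rewrite /= /bump /= -natr1 -addrA [1 + _]addrC.
Qed.

Lemma re_gt0_addn_neq0 a n : 0 < re a -> a + n%:R != 0.
Proof.
move=> a0; apply/eqP => E; have : re (a + n%:R) = 0 by rewrite E.
by rewrite reD re_nat => h; have := ltr_wpDr (ler0n R n) a0; rewrite h ltxx.
Qed.

Lemma poch_neq0 a n : 0 < re a -> poch a n != 0.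
Proof. by move=> a0; apply/prodf_neq0 => i _; exact: re_gt0_addn_neq0. Qed.

Definition kummer_term a b z (n : nat) : R[i] :=
  poch a n / poch b n * z ^+ n / n`!%:R.

Lemma natC_neq0 n : (n.+1%:R : R[i]) != 0.
Proof. by rewrite pnatr_eq0. Qed.

Lemma factC_neq0 n : (n`!%:R : R[i]) != 0.
Proof. by rewrite pnatr_eq0 -lt0n fact_gt0. Qed.

(** The contiguous relation
    [M(a, b, z) = M(a, b + 1, z) + z a / (b (b + 1)) M(a + 1, b + 2, z)], term by
    term. *)
Lemma kummer_termS a b z n : 0 < re b -> kummer_term a b z n.+1 =
  kummer_term a (b + 1) z n.+1 +
  z * a / (b * (b + 1)) * kummer_term (a + 1) (b + 2) z n.
Proof.
move=> b0; rewrite /kummer_term.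
have b10 := re_gt0D1 b0; have b20 := re_gt0D1 b10.
have E2 : b + 2 = b + 1 + 1 by rewrite -addrA -natr1.
have P0 : poch (b + 1 + 1) n != 0 by exact: poch_neq0.
have B0 : b != 0 by rewrite -[b]addr0; exact: (re_gt0_addn_neq0 0).
have B1 : b + 1 != 0 by exact: (re_gt0_addn_neq0 1).
have Bn : b + 1 + 1 + n%:R != 0 by exact: re_gt0_addn_neq0.
rewrite [poch a _]pochSl [poch b _]pochSl.
have -> : poch (b + 1) n = (b + 1) * poch (b + 1 + 1) n / (b + 1 + n%:R).
  rewrite -pochSl pochS mulfK//; exact: re_gt0_addn_neq0.
rewrite pochSl E2 factS natrM exprS -natr1.
have Bn' : b + 1 + n%:R != 0 by exact: re_gt0_addn_neq0.
have N1 : (n%:R + 1 : R[i]) != 0 by rewrite natr1 natC_neq0.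
move: (poch (b + 1 + 1) n) P0 (n`!%:R : R[i]) (factC_neq0 n) (poch (a + 1) n)
  (n%:R : R[i]) Bn' N1 (z ^+ n).
move=> pb pb0 f f0 pa m Bm m1 zn.
by field; rewrite f0 m1 pb0 B0 B1 Bm.
Qed.

Lemma series_kummerS a b z n : 0 < re b ->
  series (kummer_term a b z) n.+1 = series (kummer_term a (b + 1) z) n.+1 +
  z * a / (b * (b + 1)) * series (kummer_term (a + 1) (b + 2) z) n.
Proof.
move=> b0; rewrite /series /= !big_nat_recl//.
under eq_bigr do rewrite kummer_termS//.
by rewrite big_split /= -mulr_sumr addrA /kummer_term !poch0 !expr0.
Qed.

End Pochhammer.

(** * Decay of Kummer's function in the left half-plane *)

Section Kummer.
Variable R : realType.
Local Notation mu := (@lebesgue_measure R).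
Local Notation I01 := (`]0, 1[%classic : set R).
Implicit Types (a b c z : R[i]) (u : R).

(** By iterating the recurrence [cBetaDl]. *)
Lemma cBeta_shiftn a c n : 0 < re a -> 0 < re c ->
  cBeta (a + n%:R) c = poch a n / poch (a + c) n * cBeta a c.
Proof.
move=> a0 c0; elim: n => [|n ih]; first by rewrite addr0 !poch0 divr1 mul1r.
have an : 0 < re (a + n%:R) by rewrite reD re_nat ltr_wpDr.
have ac : 0 < re (a + c) by rewrite reD addr_gt0.
have h0 : a + n%:R + c != 0 by rewrite addrAC; exact: re_gt0_addn_neq0.
have p0 : poch (a + c) n != 0 by exact: poch_neq0.
rewrite -natr1 addrA; apply: (mulfI h0); rewrite cBetaDl// ih !pochS.
move: h0 p0; rewrite addrAC.
move: (poch _ n) (poch _ n) (cBeta a c) => x y w h0 y0.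
by field; rewrite h0 y0.
Qed.

Lemma bkernelDn a c n u : 0 < u < 1 ->
  bkernel (a + n%:R) c u = u%:C ^+ n * bkernel a c u.
Proof.
move=> u01; elim: n => [|n ih]; first by rewrite addr0 expr0 mul1r.
by rewrite -natr1 addrA bkernelDl// ih exprS mulrA.
Qed.

(** Up to the factor [cBeta a c] this is [1F1(a; a + c; z)]. *)
Definition kummer_integral a c z :=
  cintegral I01 (fun u => bkernel a c u * cexp (u%:C * z)).

Lemma nm_sum (I : Type) (s : seq I) (f : I -> R[i]) :
  nm (\sum_(i <- s) f i) <= \sum_(i <- s) nm (f i).
Proof.
elim: s => [|i s ih]; first by rewrite !big_nil nm0.
by rewrite !big_cons (le_trans (nmD _ _))// lerD2l.
Qed.

Lemma exp_partial_le (x : R) n : 0 <= x ->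
  \sum_(0 <= k < n) x ^+ k / k`!%:R <= expR x.
Proof.
move=> x0.
have : series (exp_coeff x) n <= limn (series (exp_coeff x)).
  apply: nondecreasing_cvgn_le; last exact: is_cvg_series_exp_coeff.
  by apply: nondecreasing_series => k _ _; exact: exp_coeff_ge0.
by [].
Qed.

Lemma nm_exp_partial_le z n :
  nm (\sum_(0 <= k < n) z ^+ k / k`!%:R) <= expR (nm z).
Proof.
apply: (le_trans (nm_sum _ _)); apply: le_trans (exp_partial_le n (nm_ge0 z)).
by apply: ler_sum => k _; rewrite nmM nmX nmV nm_nat.
Qed.

(** The exponential series is integrated term by term against the beta density,
    whose moments produce the quotient of Pochhammer symbols. *)
Lemma cvg_kummer_integral a c z : 0 < re a -> 0 < re c ->
  series (kummer_term a (a + c) z : nat -> R[i]^o) @ \oo -->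
   ((cBeta a c)^-1 * kummer_integral a c z : R[i]^o).
Proof.
move=> a0 c0.
have mI : measurable I01 by exact: measurable_itv.
have B0 := cBeta_neq0 a0 c0.
have E n : series (kummer_term a (a + c) z) n = (cBeta a c)^-1 *
    cintegral I01 (fun u => bkernel a c u *
      \sum_(0 <= k < n) (u%:C * z) ^+ k / k`!%:R).
  have -> : cintegral I01 (fun u => bkernel a c u *
      \sum_(0 <= k < n) (u%:C * z) ^+ k / k`!%:R) =
      \sum_(0 <= k < n) cintegral I01 (fun u =>
         (z ^+ k / k`!%:R) * bkernel (a + k%:R) c u).
    rewrite -cintegral_sum//; last first.
      move=> k; apply: cintegZ => //; apply: cinteg_bkernel => //.
      by rewrite reD re_nat ltr_wpDr.
    apply: eq_cintegral => u /I01P u01; rewrite mulr_sumr.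
    by apply: eq_bigr => k _; rewrite bkernelDn// exprMn; ring.
  rewrite /series /= mulr_sumr; apply: eq_bigr => k _.
  rewrite cintegralZ//; last first.
    by apply: cinteg_bkernel => //; rewrite reD re_nat ltr_wpDr.
  rewrite -cBetaE cBeta_shiftn// /kummer_term.
  by move: (poch _ _)^-1 (k`!%:R^-1 : R[i]) => x y; field.
rewrite (funext E : series (kummer_term a (a + c) z : nat -> R[i]^o) = _).
apply: cvgC_Ml.
apply: (@cintegral_dominated _ _ _ _ (fun u => expR (nm z) *
   (u `^ (re a - 1) * (1 - u) `^ (re c - 1)))) => //.
- move=> n; apply: cmeasM; first exact: cmeas_bkernel.
  apply: cmeas_sum => k; apply: cmeasM; last exact: cmeas_cst.
  apply: cmeasX; apply: cmeasM; last exact: cmeas_cst.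
  by apply: cmeas_real; exact: measurable_id.
- move=> u _; apply: cvgC_Ml; exact: cvg_series_cexp.
- by apply: integrable_EFinZ => //; exact: integrable_beta.
- move=> n u /I01P u01; rewrite nmM nm_bkernel// mulrC.
  rewrite ler_wpM2r ?mulr_ge0 ?powR_ge0// (le_trans (nm_exp_partial_le _ _))//.
  rewrite ler_expR nmM nmR; move/andP: u01 => [u0 u1].
  by rewrite gtr0_norm// ler_piMl ?nm_ge0// ltW.
Qed.

(** From [y / lam <= expR (y / lam)], raised to the power [lam]. *)
Lemma expRN_le_powR (lam : R) : 0 <= lam ->
  exists2 K : R, 0 <= K & forall y : R, 0 < y -> expR (- y) <= K * y `^ (- lam).
Proof.
rewrite le_eqVlt => /predU1P[<-|l0].
  exists 1 => // y y0; rewrite oppr0 powRr0 mulr1 -expR0 ler_expR.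
  by rewrite oppr_le0 ltW.
exists (lam `^ lam); first exact: powR_ge0.
move=> y y0; rewrite powRN expRN -[leLHS]mul1r.
rewrite ler_pdivrMr ?expR_gt0// mulrAC ler_pdivlMr ?powR_gt0// mul1r.
have h : y / lam <= expR (y / lam).
  by apply: le_trans (expR_ge1Dx _); rewrite lerDr.
have yl : 0 <= y / lam by rewrite divr_ge0// ltW.
have := @ge0_ler_powR _ lam (ltW l0) _ _ yl (expR_ge0 _) h.
have -> : expR (y / lam) `^ lam = expR y.
  by rewrite -expRM divfK// gt_eqF.
have -> : y `^ lam = lam `^ lam * (y / lam) `^ lam.
  by rewrite -powRM ?(ltW l0)// mulrCA divff ?mulr1// gt_eqF.
by move=> h2; rewrite ler_wpM2l// powR_ge0.
Qed.

(** Replacing [exp (- s p u)] by a multiple of [(s u) ^ (- lam)] leaves a beta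
    integral with first exponent [re a - lam > 0]. *)
Lemma kummer_integral_le a c p (lam : R) : 0 < re c -> 0 < re p ->
  0 <= lam -> lam < re a ->
  exists K : R, forall s : R, 0 < s ->
    nm (kummer_integral a c (- (s%:C * p))) <= K * s `^ (- lam).
Proof.
move=> c0 p0 l0 la; have [K K0 hK] := expRN_le_powR l0.
have mI : measurable I01 by exact: measurable_itv.
pose g u := u `^ (re a - lam - 1) * (1 - u) `^ (re c - 1).
have ig : mu.-integrable I01 (EFin \o g).
  by apply: integrable_beta => //; rewrite subr_gt0.
exists (2 * (K * re p `^ (- lam) * \int[mu]_(u in I01) g u)) => s s0.
have hm : cmeas I01 (fun u => bkernel a c u * cexp (u%:C * - (s%:C * p))).
  apply: cmeasM; first exact: cmeas_bkernel.
  apply: cmeas_cexp; apply: cmeasM; last exact: cmeas_cst.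
  by apply: cmeas_real; exact: measurable_id.
have ig2 := integrable_EFinZ (K * re p `^ (- lam) * s `^ (- lam)) mI ig.
apply: (le_trans (nm_cintegral_le mI hm ig2 _)).
  move=> u /I01P u01; have /andP[u0 u1] := u01.
  rewrite nmM nm_bkernel// nm_cexp.
  have -> : re (u%:C * - (s%:C * p)) = - (u * (s * re p)).
    by rewrite reM reN reM /= !mul0r !subr0 mulrN.
  have y0 : 0 < u * (s * re p) by rewrite !mulr_gt0.
  apply: (@le_trans _ _ (u `^ (re a - 1) * (1 - u) `^ (re c - 1) *
     (K * (u * (s * re p)) `^ (- lam)))).
    by rewrite ler_wpM2l ?hK// mulr_ge0 ?powR_ge0.
  rewrite !powRM ?mulr_ge0 ?(ltW u0) ?(ltW s0) ?(ltW p0)//.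
  rewrite /g (_ : re a - lam - 1 = re a - 1 + (- lam)); last by ring.
  rewrite (@powRD _ u (re a - 1) (- lam)); last by apply/implyP => _; rewrite gt_eqF.
  by rewrite le_eqVlt; apply/orP; left; apply/eqP; ring.
rewrite RintegralZl//.
by rewrite le_eqVlt; apply/orP; left; apply/eqP; ring.
Qed.

(** Convergence of the series is part of the statement, so that the contiguous
    relation can be summed. *)
Definition kummer_decay a b p := forall lam : R, 0 <= lam -> lam < re a ->
  exists K : R, forall s : R, 0 < s -> exists z,
    series (kummer_term a b (- (s%:C * p)) : nat -> R[i]^o) @ \oo --> (z : R[i]^o)
    /\ nm z <= K * s `^ (- lam).

(** Raising [b] by the contiguous relation reduces to [re (b - a) > 0], where
    Euler's integral representation is available. *)
Lemma kummer_decayP a b p : 0 < re a -> 0 < re b -> 0 < re p ->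
  kummer_decay a b p.
Proof.
move=> a0 b0 p0.
(* [N] counts how often [b] still has to be raised. *)
have [N hN] : exists N : nat, 0 < re (b - a) + N%:R.
  exists (Num.truncn `|re (b - a)|).+1.
  have := truncnS_gt `|re (b - a)|; have := ler_norm (- re (b - a)).
  rewrite normrN; lra.
elim: N a b a0 b0 hN => [|N ih] a b a0 b0 hN lam l0 la.
  have c0 : 0 < re (b - a) by move: hN; rewrite addr0.
  have [K hK] := kummer_integral_le c0 p0 l0 la.
  exists (nm (cBeta a (b - a))^-1 * K) => s s0.
  exists ((cBeta a (b - a))^-1 * kummer_integral a (b - a) (- (s%:C * p))).
  split; last by rewrite nmM -mulrA ler_wpM2l ?nm_ge0// hK.
  by have := @cvg_kummer_integral _ _ (- (s%:C * p)) a0 c0; rewrite addrC subrK.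
have h1 : 0 < re (b + 1 - a) + N%:R.
  by move: hN; rewrite -natr1 !reD /=; lra.
have h2 : 0 < re (b + 2 - (a + 1)) + N%:R.
  rewrite (_ : b + 2 - (a + 1) = b + 1 - a)//; first by rewrite -natr1; ring.
have b1 := re_gt0D1 b0.
have b2 : 0 < re (b + 2) by rewrite (_ : b + 2 = b + 1 + 1) ?re_gt0D1// -addrA -natr1.
have [K1 hK1] := ih _ _ a0 b1 h1 lam l0 la.
have l1 : 0 <= lam + 1 by lra.
have la1 : lam + 1 < re (a + 1) by rewrite reD /= ltrD2r.
have [K2 hK2] := ih _ _ (re_gt0D1 a0) b2 h2 _ l1 la1.
pose k := p * a / (b * (b + 1)).
exists (K1 + nm k * K2) => s s0.
have [z1 [cz1 lz1]] := hK1 s s0; have [z2 [cz2 lz2]] := hK2 s s0.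
exists (z1 + - (s%:C * k) * z2); split.
  apply/cvgC_shiftS.
  have h := cvgC_D ((cvgC_shiftS _ _).2 cz1) (cvgC_Ml (c := - (s%:C * k)) cz2).
  apply: (eq_cvgC _ h) => n.
  rewrite (@series_kummerS _ a b _ n b0).
  have -> : - (s%:C * k) = - (s%:C * p) * a / (b * (b + 1)).
    by rewrite /k; move: (b * (b + 1))^-1 => x; ring.
  by [].
rewrite (le_trans (nmD _ _))// mulrDl lerD// nmM nmN nmM nmR gtr0_norm//.
rewrite [s * nm k]mulrC -!mulrA ler_wpM2l ?nm_ge0//.
apply: (le_trans (ler_wpM2l (ltW s0) lz2)).
rewrite mulrCA opprD powRD; last by apply/implyP => _; rewrite gt_eqF.
rewrite powR_inv1; last by rewrite ltW.
rewrite [s * _]mulrC -mulrA mulVf ?mulr1 ?lexx//.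
by rewrite gt_eqF.
Qed.

Lemma hyp1F1_decay a b p (lam : R) : 0 < re a -> 0 < re b -> 0 < re p ->
  0 <= lam -> lam < re a ->
  exists K : R, forall s : R, 0 < s ->
    nm (hyp1F1 a b (- (s%:C * p))) <= K * s `^ (- lam).
Proof.
move=> a0 b0 p0 l0 la; have [K hK] := kummer_decayP a0 b0 p0 l0 la.
exists K => s s0; have [z [cz lz]] := hK s s0.
by rewrite /hyp1F1 (csumE cz).
Qed.

Lemma cmeas_hyp1F1 a b p D (f : R -> R) : 0 < re a -> 0 < re b -> 0 < re p ->
  (forall u, D u -> 0 < f u) -> measurable_fun D f ->
  cmeas D (fun u => hyp1F1 a b (- ((f u)%:C * p))).
Proof.
move=> a0 b0 p0 f0 mf; have [K hK] := kummer_decayP a0 b0 p0 (lexx 0) a0.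
apply: (@cmeas_cvg _ _ (fun n u => series (kummer_term a b (- ((f u)%:C * p))) n)).
- move=> n; apply: cmeas_sum => k.
  apply: cmeasM; last exact: cmeas_cst.
  apply: cmeasM; first exact: cmeas_cst.
  apply: cmeasX; under [X in cmeas _ X]eq_fun do rewrite -mulrN.
  by apply: cmeasM; [exact: cmeas_real|exact: cmeas_cst].
- move=> u Du; have [z [cz _]] := hK (f u) (f0 u Du).
  by rewrite /hyp1F1 (csumE cz).
Qed.

End Kummer.

(** * Integrability of the extended beta kernel *)

Section BesselKernel.
Variable R : realType.
Local Notation mu := (@lebesgue_measure R).
Local Notation I01 := (`]0, 1[%classic : set R).
Implicit Types (a b c z v q p eta gam : R[i]) (u s : R).

Lemma kummer_integralE a c z : 0 < re a -> 0 < re c ->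
  kummer_integral a c z = cBeta a c * hyp1F1 a (a + c) z.
Proof.
move=> a0 c0; rewrite /hyp1F1 (csumE (cvg_kummer_integral a0 c0)).
by rewrite mulVKf// cBeta_neq0.
Qed.

Lemma cinteg_kummer a c z : 0 < re a -> 0 < re c ->
  cinteg I01 (fun u => bkernel a c u * cexp (u%:C * z)).
Proof.
move=> a0 c0.
have ib := integrable_EFinZ (expR (nm z)) (measurable_itv _) (integrable_beta a0 c0).
apply: (cinteg_le _ _ ib); first exact: measurable_itv.
  apply: cmeasM; first exact: cmeas_bkernel.
  apply: cmeas_cexp; apply: cmeasM; last exact: cmeas_cst.
  by apply: cmeas_real; exact: measurable_id.
move=> u /I01P u01; rewrite nmM nm_bkernel// mulrC.
rewrite ler_wpM2r ?mulr_ge0 ?powR_ge0// nm_cexp ler_expR.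
rewrite (le_trans (ler_norm _))// (le_trans (le_re_nm _))// nmM nmR.
by move/andP: u01 => [u0 u1]; rewrite gtr0_norm// ler_piMl ?nm_ge0// ltW.
Qed.

Lemma preimage_half : (fun t : R => 2^-1 + (- 2^-1) * t) @^-1` I01 =
  (`]-1, 1[%classic : set R).
Proof.
have h2 : 2^-1 * 2 = 1 :> R by rewrite mulVf ?pnatr_eq0.
by apply/seteqP; split=> t /=; rewrite !in_itv /= => /andP[h1 h3];
  apply/andP; split; nra.
Qed.

(** The substitution [t = 1 - 2 u] turns the integral defining the extended
    modified Bessel function into Euler's integral for Kummer's function. *)
Lemma bessel_integralE v q z : 0 < re (v + q) -> - 2^-1 < re v ->
  cintegral `]-1, 1[ (fun t : R =>
      cpow (1 - t ^+ 2)%:C (v - 2^-1) * cpow (1 - t)%:C (q - 2^-1) *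
      cexp (- z * (t - 1)%:C)) =
  2 * (cpow 4%:C (v - 2^-1) * cpow 2%:C (q - 2^-1)) *
    kummer_integral (v + q) (v + 2^-1) (2 * z).
Proof.
move=> vq v2.
have h2 : 2^-1 * 2 = 1 :> R by rewrite mulVf ?pnatr_eq0.
have hC : (2^-1 : R[i]) = (2^-1 : R)%:C.
  by rewrite fmorphV; congr (_^-1); rewrite (rmorph_nat (real_complex R) 2).
have c0 : 0 < re (v + 2^-1) by rewrite reD hC /=; lra.
have k0 : - 2^-1 != 0 :> R by rewrite oppr_eq0 invr_eq0 pnatr_eq0.
have mI : measurable I01 by exact: measurable_itv.
have ik := cinteg_kummer (2 * z) vq c0.
rewrite /kummer_integral (cintegral_affine 2^-1 k0 mI ik) preimage_half.
have jk := cinteg_affine 2^-1 k0 mI ik; rewrite preimage_half in jk.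
set C := cpow 4%:C _ * cpow 2%:C _.
rewrite normrN ger0_norm ?invr_ge0//.
rewrite (_ : 2 * C * ((2^-1 : R)%:C * cintegral _ _) = C * cintegral `]-1, 1[
  (fun t : R => bkernel (v + q) (v + 2^-1) (2^-1 + - 2^-1 * t) *
   cexp ((2^-1 + - 2^-1 * t)%:C * (2 * z)))); last first.
  rewrite mulrA; congr (_ * _).
  by rewrite -hC mulrAC divff ?mul1r// pnatr_eq0.
rewrite -cintegralZ//; apply: eq_cintegral => t.
rewrite /= in_itv /= => /andP[t1 t2].
set u := 2^-1 + - 2^-1 * t.
have u0 : 0 < u by rewrite /u; lra.
have u1 : 0 < 1 - u by rewrite /u; lra.
have -> : 1 - t ^+ 2 = 4 * (u * (1 - u)) by rewrite /u; field.
have -> : 1 - t = 2 * u by rewrite /u; field.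
have -> : t - 1 = - (2 * u) by rewrite /u; field.
rewrite (cpow_posM (v - 2^-1)) ?mulr_gt0// (cpow_posM (v - 2^-1) u0 u1).
rewrite (cpow_posM (q - 2^-1)) ?mulr_gt0//.
have -> : - z * (- (2 * u))%:C = u%:C * (2 * z).
  rewrite rmorphN rmorphM (rmorph_nat (real_complex R) 2) /=.
  by move: (u%:C) => x; ring.
rewrite /bkernel.
have -> : v + q - 1 = (v - 2^-1) + (q - 2^-1).
  by field.
rewrite (cpow_posD (v - 2^-1) (q - 2^-1) u0).
have -> : v + 2^-1 - 1 = v - 2^-1 by field.
by rewrite /C; ring.
Qed.

Lemma re_gt0_neq0 p : 0 < re p -> p != 0.
Proof. by move=> p0; rewrite -[p]addr0; exact: (re_gt0_addn_neq0 0). Qed.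

(** Once the integral of the first case is recognized as Euler's integral, the two
    cases of the definition differ by constant factors only, so that the growth
    and the measurability of the Bessel function are those of Kummer's function. *)
Lemma eBesselI_hyp1F1 v q p : 0 < re (v + q) -> 0 < re p ->
  exists k : R[i], forall s : R, 0 < s -> eBesselI v q (- (s%:C * p)) =
    k * (cpow s%:C v *
     hyp1F1 (v + q) (2 * v + q + 2^-1) (- (s%:C * (2 * p)))).
Proof.
move=> vq p0; have pn0 := re_gt0_neq0 p0.
have p2 : - p / 2 != 0.
  by rewrite mulf_neq0 ?oppr_eq0// invr_eq0 pnatr_eq0.
have cpE s : 0 < s ->
    cpow (- (s%:C * p) / 2) v = cpow (- p / 2) v * cpow s%:C v.
  move=> s0; rewrite -cpow_scale//; congr cpow.
  by move: (2^-1 : R[i]) => x; ring.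
have argE s : 2 * - (s%:C * p) = - (s%:C * (2 * p)) by ring.
rewrite /eBesselI vq /=.
have [v2|v2] := ltP (- 2^-1) (re v).
- pose k := cpow (- p / 2) v / ((Num.sqrt pi)%:C * cGamma (v + 2^-1)) *
    (2 * (cpow 4%:C (v - 2^-1) * cpow 2%:C (q - 2^-1)) * cBeta (v + q) (v + 2^-1)).
  exists k => s s0; rewrite bessel_integralE// cpE// argE.
  rewrite kummer_integralE//; last first.
    have h2 : 2^-1 * 2 = 1 :> R by rewrite mulVf ?pnatr_eq0.
    have hC : (2^-1 : R[i]) = (2^-1 : R)%:C.
      by rewrite fmorphV; congr (_^-1); rewrite (rmorph_nat (real_complex R) 2).
    by rewrite reD hC /=; lra.
  have -> : v + q + (v + 2^-1) = 2 * v + q + 2^-1 by rewrite mulr_natl mulr2n; ring.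
  by rewrite /k; move: (_ * cGamma _)^-1 => x; ring.
- pose k := cpow (- p / 2) v * cpow 2 (2 * v + q - 2^-1) * cGamma (v + q) /
    ((Num.sqrt pi)%:C * cGamma (2 * v + q + 2^-1)).
  exists k => s s0; rewrite cpE// argE.
  by rewrite /k; move: (_ * cGamma _)^-1 => x; ring.
Qed.

(** The power [x ^ v] contributes [s ^ (re v)] and Kummer's function
    [s ^ (eps - re (v + q))]. *)
Lemma eBesselI_decay v q p (eps : R) : 0 < re (v + q) ->
  0 < re (2 * v + q + 2^-1) -> 0 < re p -> 0 < eps -> eps <= re (v + q) ->
  exists K : R, forall s : R, 0 < s ->
    nm (eBesselI v q (- (s%:C * p))) <= K * s `^ (eps - re q).
Proof.
move=> vq b0 p0 e0 evq; have [k hk] := eBesselI_hyp1F1 vq p0.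
have p20 : 0 < re (2 * p) by rewrite mulr_natl mulr2n reD addr_gt0.
have l0 : 0 <= re (v + q) - eps by rewrite subr_ge0.
have l1 : re (v + q) - eps < re (v + q) by rewrite ltrBlDr ltrDl.
have [K hK] := hyp1F1_decay vq b0 p20 l0 l1.
exists (nm k * K) => s s0; rewrite hk// nmM -mulrA ler_wpM2l ?nm_ge0//.
rewrite nmM nm_cpow_pos//.
apply: (le_trans (ler_wpM2l (powR_ge0 _ _) (hK s s0))).
rewrite mulrCA -powRD; last by apply/implyP => _; rewrite gt_eqF.
by rewrite (_ : re v + _ = eps - re q)// reD; ring.
Qed.

Lemma cmeas_eBesselI v q p D (f : R -> R) : 0 < re (v + q) ->
  0 < re (2 * v + q + 2^-1) -> 0 < re p ->
  (forall u, D u -> 0 < f u) -> measurable_fun D f ->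
  cmeas D (fun u => eBesselI v q (- ((f u)%:C * p))).
Proof.
move=> vq b0 p0 f0 mf; have [k hk] := eBesselI_hyp1F1 vq p0.
have p20 : 0 < re (2 * p) by rewrite mulr_natl mulr2n reD addr_gt0.
apply: (@eq_cmeas _ _ (fun u => k * (cpow (f u)%:C v *
   hyp1F1 (v + q) (2 * v + q + 2^-1) (- ((f u)%:C * (2 * p)))))).
  by move=> u Du; rewrite hk// f0.
apply: cmeasM; first exact: cmeas_cst.
by apply: cmeasM; [exact: cmeas_cpow|exact: cmeas_hyp1F1].
Qed.

(** The integrand of [eBeta mu sigma v q p eta gam]. *)
Definition ekernel (m sg : R) v q p eta gam u : R[i] :=
  cpow u%:C eta * cpow (1 - u)%:C gam *
  eBesselI (v + 2^-1) q (- p / (u `^ m * (1 - u) `^ sg)%:C).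

(** With [s = u ^ (- mu) (1 - u) ^ (- sigma)] the Bessel factor is
    [O(s ^ (eps - re q))], which leaves a beta density whose exponents tend
    to [re (eta + mu q)] and [re (gam + sigma q)] as [eps] tends to [0]. *)
Lemma cinteg_ekernel (m sg : R) v q p eta gam : 0 <= m -> 0 <= sg ->
  0 < re p -> 0 < re (v + q + 2^-1) -> 0 < re (2 * v + q + 3 / 2) ->
  -1 < re (eta + m%:C * q) -> -1 < re (gam + sg%:C * q) ->
  cinteg I01 (ekernel m sg v q p eta gam).
Proof.
move=> m0 sg0 p0 vq0 b0 hm hsg.
have vq : 0 < re (v + 2^-1 + q) by rewrite addrAC.
have vb : 0 < re (2 * (v + 2^-1) + q + 2^-1).
  by rewrite (_ : _ + 2^-1 = 2 * v + q + 3 / 2)//; field.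
have {}hm : 0 < re eta + m * re q + 1.
  by move: hm; rewrite reD reM /= mul0r subr0; lra.
have {}hsg : 0 < re gam + sg * re q + 1.
  by move: hsg; rewrite reD reM /= mul0r subr0; lra.
have m1 : 0 < m + 1 by lra.
have sg1 : 0 < sg + 1 by lra.
(* [m * eps] has to stay below the gap between the first exponent and [-1];
   the denominator [m + 1] also covers [m = 0]. Same for [sg]. *)
pose e1 := (re eta + m * re q + 1) / (m + 1).
pose e2 := (re gam + sg * re q + 1) / (sg + 1).
have e10 : 0 < e1 by rewrite divr_gt0.
have e20 : 0 < e2 by rewrite divr_gt0.
pose eps := Num.min (re (v + 2^-1 + q)) (Num.min e1 e2).
have eps0 : 0 < eps by rewrite !lt_min vq e10 e20.
have epsv : eps <= re (v + 2^-1 + q) by rewrite ge_min lexx.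
have epse1 : eps <= e1 by rewrite !ge_min lexx orbT.
have epse2 : eps <= e2 by rewrite !ge_min lexx !orbT.
have [K hK] := eBesselI_decay vq vb p0 eps0 epsv.
have E1 : 0 < re eta + m * (re q - eps) + 1.
  have : m * eps <= m * e1 by rewrite ler_wpM2l.
  have : (m + 1) * e1 = re eta + m * re q + 1 by rewrite mulrC divfK ?gt_eqF.
  by move=> h1 h2; rewrite mulrBr; move: h1; rewrite mulrDl mul1r; lra.
have E2 : 0 < re gam + sg * (re q - eps) + 1.
  have : sg * eps <= sg * e2 by rewrite ler_wpM2l.
  have : (sg + 1) * e2 = re gam + sg * re q + 1 by rewrite mulrC divfK ?gt_eqF.
  by move=> h1 h2; rewrite mulrBr; move: h1; rewrite mulrDl mul1r; lra.
have ib := integrable_EFinZ K (measurable_itv _) (integrable_beta E1 E2).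
have sE (u : R) : - p / (u `^ m * (1 - u) `^ sg)%:C =
    - (((u `^ m * (1 - u) `^ sg)^-1)%:C * p).
  rewrite (_ : ((_)^-1)%:C = ((u `^ m * (1 - u) `^ sg)%:C)^-1); last exact: fmorphV.
  by rewrite mulNr mulrC.
have spos u : 0 < u < 1 -> 0 < (u `^ m * (1 - u) `^ sg)^-1.
  by move=> /andP[u0 u1]; rewrite invr_gt0 mulr_gt0 ?powR_gt0 ?subr_gt0.
have mo := @measurable_onem R I01.
apply: (cinteg_le _ _ ib); first exact: measurable_itv.
- apply: cmeasM.
    apply: cmeasM.
      by apply: cmeas_cpow => // u /I01P/andP[].
    apply: (@cmeas_cpow _ _ (fun u => 1 - u)) => //.
    by move=> u /I01P/andP[u0 u1]; rewrite subr_gt0.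
  apply: (@eq_cmeas _ _ (fun u => eBesselI (v + 2^-1) q
     (- (((u `^ m * (1 - u) `^ sg)^-1)%:C * p)))).
    by move=> u _; rewrite sE.
  apply: (@cmeas_eBesselI _ _ _ _ (fun u => (u `^ m * (1 - u) `^ sg)^-1)) => //.
  apply: measurable_invr.
    by move=> u /I01P u01; rewrite -invr_gt0; exact: spos.
  apply: measurable_funM; first exact: measurable_powRf.
  exact: measurable_powRf.
- move=> u /I01P u01; have /andP[u0 u1] := u01.
  have u1' : 0 < 1 - u by rewrite subr_gt0.
  rewrite /ekernel sE !nmM !nm_cpow_pos//.
  apply: (le_trans (ler_wpM2l _ (hK _ (spos u u01)))).
    by rewrite mulr_ge0 ?powR_ge0.
  have powV (x : R) e : 0 < x -> (x^-1) `^ e = x `^ (- e).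
    by move=> x0; rewrite -powR_inv1 ?ltW// -powRrM mulN1r.
  rewrite powV; last by rewrite mulr_gt0 ?powR_gt0.
  rewrite powRM ?powR_ge0// -!powRrM.
  rewrite !addrK (@powRD _ u); last by apply/implyP => _; rewrite gt_eqF.
  rewrite (@powRD _ (1 - u)); last by apply/implyP => _; rewrite gt_eqF.
  by rewrite !opprB le_eqVlt; apply/orP; left; apply/eqP; ring.
Qed.

End BesselKernel.

(** * The binomial series with a natural exponent *)

Section BinomialSeries.
Variable R : realType.

(** The exponent [r + 1] rather than [r] keeps the binomial coefficient in its
    usual form. *)
Lemma poch_bin r n : poch (r.+1%:R : R[i]) n / n`!%:R = 'C(n + r, n)%:R.
Proof.
have h : poch (r.+1%:R : R[i]) n * r`!%:R = (n + r)`!%:R.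
  elim: n => [|n ih]; first by rewrite poch0 mul1r.
  rewrite pochS mulrAC ih -natrD -natrM.
  by rewrite [in RHS]addSn factS mulnC addSn (addnC r).
apply: (mulIf (factC_neq0 R n)); rewrite divfK ?factC_neq0//.
apply: (mulIf (factC_neq0 R r)); rewrite h -!natrM -mulnA.
by have := bin_fact (leq_addr r n); rewrite addKn => ->.
Qed.

Definition binsum (T : nzRingType) r (y : T) N :=
  \sum_(0 <= n < N) 'C(n + r, n)%:R * y ^+ n.

Lemma binsum0 (T : comNzRingType) (y : T) N : (1 - y) * binsum 0 y N = 1 - y ^+ N.
Proof.
elim: N => [|N ih]; first by rewrite /binsum big_geq// mulr0 expr0 subrr.
rewrite /binsum big_nat_recr//= mulrDr -/(binsum 0 y N) ih addn0 binn exprS; ring.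
Qed.

(** Multiplying by [1 - y] lowers the exponent by one, by Pascal's rule. *)
Lemma binsumS (T : comNzRingType) r (y : T) N : (1 - y) * binsum r.+1 y N.+1 =
  binsum r y N.+1 - 'C(N + r.+1, N)%:R * y ^+ N.+1.
Proof.
elim: N => [|N ih].
  by rewrite /binsum !big_nat1 !bin0 expr0 expr1; ring.
rewrite /binsum big_nat_recr//= mulrDr -/(binsum r.+1 y N.+1) ih.
rewrite [in RHS]big_nat_recr//= -/(binsum r y N.+1).
have -> : 'C(N.+1 + r.+1, N.+1) = ('C(N.+1 + r, N.+1) + 'C(N + r.+1, N))%N.
  by rewrite addSn binS addnS addSn.
rewrite natrD !exprS; ring.
Qed.

Implicit Types (rho : R) (y z w : R[i]).

(** Iterating [binsumS] and dropping the subtracted term. *)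
Lemma binsum_le r rho N : 0 <= rho < 1 -> binsum r rho N <= (1 - rho)^-1 ^+ r.+1.
Proof.
move=> /andP[p0 p1]; have q0 : 0 < 1 - rho by rewrite subr_gt0.
elim: r N => [|r ih] N.
  rewrite expr1 -[leRHS]mul1r ler_pdivlMr// mulrC binsum0.
  by rewrite gerBl exprn_ge0.
case: N => [|N].
  by rewrite /binsum big_geq// exprn_ge0 ?invr_ge0 ?ltW.
rewrite exprSr ler_pdivlMr// mulrC binsumS.
rewrite (le_trans _ (ih N.+1))// gerBl mulr_ge0// exprn_ge0//.
Qed.

(** These are the terms of a convergent series of nonnegative numbers. *)
Lemma binterm_cvg0 r rho : 0 <= rho < 1 ->
  (fun n => 'C(n + r, n)%:R * rho ^+ n) @ \oo --> (0 : R).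
Proof.
move=> rho01; have /andP[p0 p1] := rho01.
apply: cvg_series_cvg_0.
apply: nondecreasing_is_cvgn.
  by apply: nondecreasing_series => n _ _; rewrite mulr_ge0 ?exprn_ge0.
by exists ((1 - rho)^-1 ^+ r.+1) => _ [n _ <-]; exact: binsum_le.
Qed.

Lemma nm_binsum_le r y rho N : nm y <= rho -> nm (binsum r y N) <= binsum r rho N.
Proof.
move=> yr; apply: (le_trans (nm_sum _ _)); apply: ler_sum => n _.
rewrite nmM nmX nm_nat ler_wpM2l// lerXn2r ?nnegrE ?nm_ge0//.
exact: le_trans (nm_ge0 y) yr.
Qed.

Lemma cvg_binsum r y : nm y < 1 ->
  (binsum r y : nat -> R[i]^o) @ \oo --> ((1 - y)^-1 ^+ r.+1 : R[i]^o).
Proof.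
move=> y1.
have y01 : 0 <= nm y < 1 by rewrite nm_ge0.
have q0 : 1 - y != 0.
  by apply/eqP => /subr0_eq E; move: y1; rewrite -E nm1 ltxx.
have yc m : ((fun n => - ('C(n + m, n)%:R * y ^+ n.+1)) : nat -> R[i]^o) @ \oo -->
    (0 : R[i]^o).
  apply/cvg_nmP; apply: (cvg0_le _ (binterm_cvg0 m y01)) => n.
  rewrite nm_ge0 /= subr0 nmN nmM nmX nm_nat ler_wpM2l// exprS.
  by rewrite ler_piMl ?exprn_ge0 ?nm_ge0// ltW.
apply/cvgC_shiftS; elim: r => [|r ih].
  have h : ((fun n => (1 - y)^-1 * (1 + - ('C(n + 0, n)%:R * y ^+ n.+1))) : nat -> R[i]^o)
     @ \oo --> ((1 - y)^-1 * (1 + 0) : R[i]^o).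
    apply: cvgC_Ml; apply: cvgC_D; last exact: yc.
    by apply/cvg_reimP; split; exact: cvg_cst.
  rewrite expr1; move: h; rewrite addr0 mulr1; apply: eq_cvgC => n.
  by rewrite addn0 binn mul1r -binsum0 mulKf.
have h := cvgC_Ml (c := (1 - y)^-1) (cvgC_D ih (yc r.+1)).
move: h; rewrite addr0 -exprS; apply: eq_cvgC => n.
by rewrite -binsumS mulKf.
Qed.

End BinomialSeries.

(** * The slit plane *)

Section SlitPlane.
Variable R : realType.
Implicit Types (w z : R[i]) (s u : R).

Lemma slitE w : (1 <= w) = (im w == 0) && (1 <= re w).
Proof. by rewrite lecE. Qed.

(** The slit plane is star-shaped about [0]; analytic continuation is carried
    along the segments issued from [0]. *)
Lemma slit_star w s : ~~ (1 <= w) -> 0 <= s <= 1 -> ~~ (1 <= s%:C * w).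
Proof.
rewrite !slitE => h /andP[s0 s1]; apply: contra h.
rewrite imM reM /= !mul0r addr0 subr0 => /andP[h1 h2].
have s0' : s != 0.
  by apply: contraTneq h2 => ->; rewrite mul0r -ltNge ltr01.
rewrite mulf_eq0 (negPf s0') /= in h1; rewrite h1 /=.
have w0 : 0 <= re w.
  rewrite -(pmulr_rge0 (re w) (x := s)) ?lt_neqAle 1?eq_sym ?s0' ?s0//.
  exact: le_trans h2.
by apply: (le_trans h2); rewrite ler_piMl.
Qed.

(** The segment joining [1] to [1 - w] avoids [0]. For nonreal [w] it is split at
    [u = 1 / (2 |w|)]: before this point [1] dominates, after it the imaginary
    part does. *)
Lemma slit_dist w : ~~ (1 <= w) ->
  exists2 d : R, 0 < d & forall u, 0 < u < 1 -> d <= nm (1 - u%:C * w).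
Proof.
rewrite slitE negb_and => wcut.
have reE u : re (1 - u%:C * w) = 1 - u * re w.
  by rewrite reB reM /= mul0r subr0.
have imE u : im (1 - u%:C * w) = - (u * im w).
  by rewrite imB imM /= mul0r addr0 sub0r.
have [w0|w0] := eqVneq (im w) 0.
  have w1 : re w < 1 by move: wcut; rewrite w0 eqxx /= ltNge.
  exists (Num.min 1 (1 - re w)); first by rewrite lt_min ltr01 subr_gt0.
  move=> u /andP[u0 u1]; apply: le_trans (le_re_nm _); rewrite reE.
  apply: le_trans (ler_norm _); rewrite ge_min.
  have [rw|rw] := lerP (re w) 0.
    by rewrite lerDl oppr_ge0 mulr_ge0_le0 ?rw ?(ltW u0).
  by rewrite lerD2l lerN2 ler_piMl ?orbT ?(ltW u1) ?(ltW rw).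
have n0 : 0 < `|im w| by rewrite normr_gt0.
have m0 : 0 < nm w by apply: lt_le_trans n0 (le_im_nm w).
have h2 : 2^-1 * 2 = 1 :> R by rewrite mulVf ?pnatr_eq0.
exists (Num.min 2^-1 (`|im w| / (2 * nm w))).
  by rewrite lt_min invr_gt0 ltr0n divr_gt0// mulr_gt0.
move=> u /andP[u0 u1]; rewrite ge_min.
have [uw|uw] := lerP (u * nm w) 2^-1.
  apply/orP; left.
  have : nm (1 : R[i]) <= nm (1 - u%:C * w) + nm (u%:C * w).
    by apply: le_trans (nmD _ _); rewrite subrK.
  by rewrite nm1 nmM nmR gtr0_norm//; lra.
apply/orP; right; apply: le_trans (le_im_nm _); rewrite imE normrN normrM.
rewrite gtr0_norm// [u * _]mulrC ler_wpM2l ?normr_ge0//.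
rewrite invfM -ler_pdivlMr ?invr_gt0// invrK; exact: ltW.
Qed.

End SlitPlane.

(** * Euler's hypergeometric integral and its power series *)

Section CauchyTransform.
Variable R : realType.
Local Notation mu := (@lebesgue_measure R).
Local Notation I01 := (`]0, 1[%classic : set R).
Implicit Types (w z c : R[i]) (u : R).
Variable K : R -> R[i].
Hypothesis iK : cinteg I01 K.

(** Euler's integral with density [K] for a hypergeometric function with first
    parameter [r + 1]. *)
Definition stieltjes (r : nat) w : R[i] :=
  cintegral I01 (fun u => K u * (1 - u%:C * w)^-1 ^+ r.+1).

(** The Taylor coefficient of order [n] of [stieltjes r] at [w]. *)
Definition moment (r : nat) w n : R[i] :=
  cintegral I01 (fun u => K u * ('C(n + r, n)%:R * u%:C ^+ n *
    (1 - u%:C * w)^-1 ^+ (n + r.+1))).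

Let mI : measurable I01. Proof. exact: measurable_itv. Qed.

Lemma cmeas_resolvent w : (forall u, 0 < u < 1 -> 1 - u%:C * w != 0) ->
  cmeas I01 (fun u => (1 - u%:C * w)^-1).
Proof.
move=> h; apply: cmeasV; first by move=> u /I01P; exact: h.
apply: cmeasD; first exact: cmeas_cst.
under [X in cmeas _ X]eq_fun do rewrite -mulrN.
apply: cmeasM; last exact: cmeas_cst.
by apply: cmeas_real; exact: measurable_id.
Qed.

Lemma cmeas_id : cmeas I01 (fun u : R => u%:C).
Proof. by apply: cmeas_real; exact: measurable_id. Qed.

Lemma cinteg_mul_bounded (h : R -> R[i]) (M : R) : cmeas I01 h ->
  (forall u, 0 < u < 1 -> nm (h u) <= M) -> cinteg I01 (fun u => K u * h u).
Proof.
move=> mh hM; have ig := integrable_EFinZ M mI (cinteg_nm mI iK).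
apply: (cinteg_le mI _ ig); first by apply: cmeasM => //; exact: cinteg_cmeas.
move=> u /I01P u01; rewrite nmM mulrC.
have M0 : 0 <= M by apply: le_trans (nm_ge0 _) (hM u u01).
apply: ler_pM; rewrite ?nm_ge0//; [exact: hM|exact: nm_le_reim].
Qed.

Lemma nm_invX_le z (d : R) n : 0 < d -> d <= nm z -> nm (z^-1 ^+ n) <= d^-1 ^+ n.
Proof.
move=> d0 dz; have z0 : 0 < nm z := lt_le_trans d0 dz.
rewrite nmX nmV; apply: lerXn2r; rewrite ?nnegrE ?invr_ge0 ?nm_ge0 ?(ltW d0)//.
by rewrite lef_pV2.
Qed.

Lemma resolvent_neq0 w (d : R) : 0 < d ->
  (forall u, 0 < u < 1 -> d <= nm (1 - u%:C * w)) ->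
  forall u, 0 < u < 1 -> 1 - u%:C * w != 0.
Proof.
move=> d0 h u u01; rewrite -nm_gt0; exact: lt_le_trans d0 (h u u01).
Qed.

Lemma cinteg_stieltjes r w (d : R) : 0 < d ->
  (forall u, 0 < u < 1 -> d <= nm (1 - u%:C * w)) ->
  cinteg I01 (fun u => K u * (1 - u%:C * w)^-1 ^+ r.+1).
Proof.
move=> d0 h; have nz := resolvent_neq0 d0 h.
apply: (@cinteg_mul_bounded _ (d^-1 ^+ r.+1)).
  by apply: cmeasX; exact: cmeas_resolvent.
by move=> u u01; apply: nm_invX_le => //; exact: h.
Qed.

Lemma cinteg_moment r w (d : R) n : 0 < d ->
  (forall u, 0 < u < 1 -> d <= nm (1 - u%:C * w)) ->
  cinteg I01 (fun u => K u * ('C(n + r, n)%:R * u%:C ^+ n *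
    (1 - u%:C * w)^-1 ^+ (n + r.+1))).
Proof.
move=> d0 h; have nz := resolvent_neq0 d0 h.
apply: (@cinteg_mul_bounded _ ('C(n + r, n)%:R * d^-1 ^+ (n + r.+1))).
  apply: cmeasM.
    apply: cmeasM; first exact: cmeas_cst.
    by apply: cmeasX; exact: cmeas_id.
  by apply: cmeasX; exact: cmeas_resolvent.
move=> u u01; have /andP[u0 u1] := u01.
rewrite !nmM nm_nat [nm (u%:C ^+ n)]nmX nmR gtr0_norm// -mulrA ler_wpM2l//.
apply: le_trans (nm_invX_le (n + r.+1) d0 (h u u01)).
by rewrite ler_piMl ?nm_ge0// exprn_ile1// ltW.
Qed.

(** Expand the integrand by the binomial series around [w0] and integrate term by
    term; the ratio of the dominating geometric series is [|w - w0| / d]. *)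
Lemma stieltjes_series r w0 w (d : R) : 0 < d ->
  (forall u, 0 < u < 1 -> d <= nm (1 - u%:C * w0)) -> nm (w - w0) < d ->
  series ((fun n => moment r w0 n * (w - w0) ^+ n) : nat -> R[i]^o) @ \oo -->
    (stieltjes r w : R[i]^o).
Proof.
move=> d0 h wd; have nz := resolvent_neq0 d0 h.
pose rho := nm (w - w0) / d.
have rho01 : 0 <= rho < 1.
  by rewrite /rho divr_ge0 ?nm_ge0 ?(ltW d0)//= ltr_pdivrMr// mul1r.
pose y u := (u%:C * (w - w0)) / (1 - u%:C * w0).
have yrho u : 0 < u < 1 -> nm (y u) <= rho.
  move=> u01; have /andP[u0 u1] := u01.
  rewrite /y nmM nmM nmV nmR gtr0_norm// /rho; apply: ler_pM.
  - by rewrite mulr_ge0 ?nm_ge0 ?(ltW u0).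
  - by rewrite invr_ge0 nm_ge0.
  - by rewrite ler_piMl ?nm_ge0 ?(ltW u1).
  - by rewrite -nmV -[nm _]expr1 -[d^-1]expr1 -nmX nm_invX_le// h.
have my : cmeas I01 y.
  apply: cmeasM; last exact: cmeas_resolvent.
  by apply: cmeasM; [exact: cmeas_id|exact: cmeas_cst].
have E n : cintegral I01 (fun u => K u * ((1 - u%:C * w0)^-1 ^+ r.+1 *
      binsum r (y u) n)) =
    series ((fun n => moment r w0 n * (w - w0) ^+ n) : nat -> R[i]^o) n.
  rewrite /series /=.
  under eq_bigr => k _.
    rewrite /moment mulrC -(cintegralZ _ mI (cinteg_moment r k d0 h)).
    over.
  rewrite -cintegral_sum//; last first.
    by move=> k; apply: cintegZ => //; exact: (cinteg_moment _ _ d0 h).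
  apply: eq_cintegral => u _; rewrite /binsum !mulr_sumr; apply: eq_bigr => k _.
  rewrite /y !exprMn exprD; move: ((1 - u%:C * w0)^-1 ^+ k) => t; ring.
apply: (eq_cvgC E).
apply: (@cintegral_dominated _ _ _ _ (fun u => (d^-1 ^+ r.+1 * (1 - rho)^-1 ^+ r.+1) *
  (`|re (K u)| + `|im (K u)|))) => //.
- move=> n; apply: cmeasM; first exact: cinteg_cmeas.
  apply: cmeasM; first by apply: cmeasX; exact: cmeas_resolvent.
  apply: cmeas_sum => k; apply: cmeasM; first exact: cmeas_cst.
  exact: cmeasX.
- move=> u /I01P u01; apply: cvgC_Ml.
  have -> : (1 - u%:C * w)^-1 ^+ r.+1 =
      (1 - u%:C * w0)^-1 ^+ r.+1 * (1 - y u)^-1 ^+ r.+1.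
    rewrite -exprMn -invfM; congr (_^-1 ^+ _).
    rewrite mulrBr mulr1 /y mulrCA divff ?nz// mulr1; ring.
  apply: cvgC_Ml; apply: cvg_binsum.
  by apply: le_lt_trans (yrho u u01) _; case/andP: rho01.
- by apply: integrable_EFinZ => //; exact: cinteg_nm.
- move=> n u /I01P u01; rewrite nmM mulrC; apply: ler_pM; rewrite ?nm_ge0//.
    rewrite nmM; apply: ler_pM; rewrite ?nm_ge0//.
      exact: nm_invX_le (h u u01).
    apply: (le_trans (nm_binsum_le _ _ (yrho u u01))).
    exact: binsum_le.
  exact: nm_le_reim.
Qed.

Lemma stieltjes_analytic r c w : ~~ (1 <= w) ->
  analytic_at (fun w => c * stieltjes r w) w.
Proof.
move=> /slit_dist[d d0 h]; exists (fun n => c * moment r w n), d; split=> // w' wd.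
have := cvgC_Ml (c := c) (@stieltjes_series r w w' d d0 h wd); apply: eq_cvgC => n.
by rewrite /series /= mulr_sumr; apply: eq_bigr => k _; rewrite mulrA.
Qed.

End CauchyTransform.

(** * Uniqueness of analytic continuation to the slit plane *)

Section IdentityTheorem.
Variable R : realType.
Implicit Types (w z : R[i]) (e c : nat -> R[i]) (t : R).

Lemma cvgC_bounded (s : nat -> R[i]) z : (s : nat -> R[i]^o) @ \oo --> (z : R[i]^o) ->
  exists M : R, forall n, nm (s n) <= M.
Proof.
move=> /cvg_nmP h.
have [M [_ /(_ (M + 1) ltac:(lra)) hM]] := cvg_seq_bounded (cvgP _ h).
exists (nm z + (M + 1)) => n.
rewrite -[s n](subrK z) addrC (le_trans (nmD _ _))// lerD2l.
exact: le_trans (ler_norm _) (hM n I).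
Qed.

(** The terms [e_n t ^ n] are bounded by a constant, so at [q t] the sum of all
    terms but the first is [O(q)]. *)
Lemma power_series_head_eq0 e t : 0 < t ->
  (forall s : R, 0 < s <= t ->
    series ((fun n => e n * s%:C ^+ n) : nat -> R[i]^o) @ \oo --> (0 : R[i]^o)) ->
  e 0%N = 0.
Proof.
move=> t0 es.
have h2 : 2^-1 * 2 = 1 :> R by rewrite mulVf ?pnatr_eq0.
have [M hM] := cvgC_bounded (es t ltac:(rewrite t0 lexx//)).
have M0 : 0 <= M by apply: le_trans (hM 0%N); rewrite nm_ge0.
(* Each term is the difference of two consecutive partial sums. *)
have term n : nm (e n * t%:C ^+ n) <= 2 * M.
  have -> : e n * t%:C ^+ n = series (fun n => e n * t%:C ^+ n : R[i]^o) n.+1 -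
      series (fun n => e n * t%:C ^+ n : R[i]^o) n.
    by rewrite /series /= big_nat_recr//= addrAC subrr add0r.
  by rewrite (le_trans (nmD _ _))// nmN mulr_natl mulr2n lerD.
have tail q N : 0 <= q <= 2^-1 ->
    \sum_(0 <= k < N) 2 * M * q ^+ k.+1 <= 4 * M * q.
  move=> /andP[q0 q2]; have q1 : 0 < 1 - q.
    by lra.
  have E : (1 - q) * (\sum_(0 <= k < N) q ^+ k) = 1 - q ^+ N.
    elim: N => [|N ih]; first by rewrite big_geq// mulr0 expr0 subrr.
    by rewrite big_nat_recr//= mulrDr ih exprS; ring.
  have L : \sum_(0 <= k < N) q ^+ k <= 2.
    have S0 : 0 <= \sum_(0 <= k < N) q ^+ k by apply: sumr_ge0 => k _; exact: exprn_ge0.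
    have : (1 - q) * (\sum_(0 <= k < N) q ^+ k) <= 1.
      by rewrite E gerBl exprn_ge0.
    have : 2^-1 * (\sum_(0 <= k < N) q ^+ k) <= (1 - q) * (\sum_(0 <= k < N) q ^+ k).
      by rewrite ler_wpM2r//; lra.
    lra.
  under eq_bigr do rewrite exprS mulrA.
  rewrite -mulr_sumr; apply: (le_trans (ler_wpM2l _ L)).
    by rewrite !mulr_ge0.
  by rewrite le_eqVlt; apply/orP; left; apply/eqP; ring.
have key q : 0 < q <= 2^-1 -> nm (e 0%N) <= 4 * M * q.
  move=> /andP[q0 q2].
  have q1 : q <= 1.
    by lra.
  have st : 0 < q * t <= t by rewrite mulr_gt0//= ler_piMl// ltW.
  have /cvg_nmP h := es _ st.
  have hl : (fun n => nm (series (fun n => e n * (q * t)%:C ^+ n : R[i]^o) n.+1 - 0) +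
      4 * M * q) @ \oo --> 0 + 4 * M * q.
    apply: cvgD; last exact: cvg_cst.
    by rewrite (cvg_shiftS (fun n =>
      nm (series (fun n => e n * (q * t)%:C ^+ n : R[i]^o) n - 0))).
  rewrite -[leRHS]add0r.
  apply: (ler_cvg_to (cvg_cst (nm (e 0%N))) hl); apply: nearW => n.
  rewrite subr0 /series /= big_nat_recl// expr0 mulr1.
  set T := \sum_(0 <= k < n) _.
  rewrite -{1}[e 0%N](addrK T) (le_trans (nmD _ _))// nmN lerD2l.
  apply: (le_trans (nm_sum _ _)); apply: le_trans (tail q n _); last first.
    by rewrite ltW.
  apply: ler_sum => k _.
  rewrite rmorphM exprMn mulrCA nmM nmX nmR gtr0_norm// mulrC.
  by rewrite ler_wpM2r// exprn_ge0// ltW.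
apply/eqP; rewrite -nm_eq0 eq_le nm_ge0 andbT.
apply/ler_addgt0Pl => eps eps0; rewrite addr0.
pose q := Num.min 2^-1 (eps / (4 * M + 1)).
have M1 : 0 < 4 * M + 1 by lra.
have q0 : 0 < q by rewrite lt_min invr_gt0 ltr0n divr_gt0.
apply: (le_trans (key q _)); first by rewrite q0 ge_min lexx.
have qe : q * (4 * M + 1) <= eps by rewrite -ler_pdivlMr// ge_min lexx orbT.
by apply: le_trans qe; rewrite mulrC ler_wpM2l ?ltW//; lra.
Qed.

(** Remove the constant term, divide by [s], and repeat. *)
Lemma power_series_eq0 e t : 0 < t ->
  (forall s : R, 0 < s <= t ->
    series ((fun n => e n * s%:C ^+ n) : nat -> R[i]^o) @ \oo --> (0 : R[i]^o)) ->
  forall n, e n = 0.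
Proof.
move=> t0 es n; elim: n e es => [|n ih] e es.
  exact: power_series_head_eq0 t0 es.
apply: (ih (fun n => e n.+1)) => s st.
have s0 : s%:C != 0 by rewrite -nm_gt0 nmR normr_gt0; case/andP: st => ? _; rewrite gt_eqF.
have e0 := power_series_head_eq0 t0 es.
have := cvgC_Ml (c := s%:C^-1) ((cvgC_shiftS _ _).2 (es s st)).
rewrite mulr0; apply: eq_cvgC => m.
rewrite /series /= big_nat_recl// e0 mul0r add0r mulr_sumr; apply: eq_bigr => k _.
by rewrite exprS mulrCA mulKf.
Qed.

(** Along a segment issued from [0], the supremum of the parameters up to which
    the two functions agree cannot be interior, because a power series vanishing
    on one side of its centre vanishes. *)
Lemma slit_identity (g1 g2 : R[i] -> R[i]) :
  (forall w, ~~ (1 <= w) -> analytic_at g1 w) ->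
  (forall w, ~~ (1 <= w) -> analytic_at g2 w) ->
  (forall w, nm w < 1 -> g1 w = g2 w) ->
  forall w, ~~ (1 <= w) -> g1 w = g2 w.
Proof.
move=> an1 an2 g12 w wcut.
have [->|wn0] := eqVneq w 0; first by apply: g12; rewrite nm0.
have w0 : 0 < nm w by rewrite nm_gt0.
pose P (s : R) := forall s' : R, 0 <= s' <= s -> g1 (s'%:C * w) = g2 (s'%:C * w).
pose A : set R := [set s | 0 <= s <= 1 /\ P s].
have ubA : ubound A 1 by move=> s [/andP[_ s1] _].
pose s1 := Num.min 1 (2 * nm w)^-1.
have s10 : 0 < s1 by rewrite lt_min ltr01 invr_gt0 mulr_gt0.
have s1A : A s1.
  split; first by rewrite ltW//= ge_min lexx.
  move=> s' /andP[s0 ss]; apply: g12; rewrite nmM nmR ger0_norm//.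
  have : s' <= (2 * nm w)^-1 by apply: le_trans ss _; rewrite ge_min lexx orbT.
  rewrite invfM => h.
  apply: le_lt_trans (_ : 2^-1 < 1); last by rewrite invf_lt1 ?ltr1n.
  by rewrite -ler_pdivlMr.
have supA : has_sup A by split; [exists s1|exists 1].
(* [s0 * w] is the farthest point reached by the agreement. *)
pose s0 := sup A.
have s0_ge : s1 <= s0 by exact: ub_le_sup supA.2 _ s1A.
have s0_le : s0 <= 1 by apply: ge_sup => //; exists s1.
have s00 : 0 < s0 by exact: lt_le_trans s10 s0_ge.
have below s : 0 <= s < s0 -> g1 (s%:C * w) = g2 (s%:C * w).
  move=> /andP[sge slt].
  have d0 : 0 < s0 - s by rewrite subr_gt0.
  have [s' [_ Ps'] ss'] := sup_adherent d0 supA.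
  by apply: Ps'; rewrite sge /=; move: ss'; rewrite opprB addrCA subrr addr0 => /ltW.
have cut0 : ~~ (1 <= s0%:C * w) by apply: slit_star => //; rewrite (ltW s00).
have [c1 [r1 [r10 h1]]] := an1 _ cut0; have [c2 [r2 [r20 h2]]] := an2 _ cut0.
pose r := Num.min r1 r2.
have r0 : 0 < r by rewrite lt_min r10.
pose d := r / (2 * nm w).
have d0 : 0 < d by rewrite divr_gt0// mulr_gt0.
have near s : `|s - s0| <= d ->
    series ((fun n => (c1 n - c2 n) * ((s - s0)%:C * w) ^+ n) : nat -> R[i]^o) @ \oo -->
     (g1 (s%:C * w) - g2 (s%:C * w) : R[i]^o).
  move=> sd.
  have E : s%:C * w - s0%:C * w = (s - s0)%:C * w by rewrite -mulrBl -rmorphB.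
  have lt_r : nm (s%:C * w - s0%:C * w) < r.
    rewrite E nmM nmR; apply: le_lt_trans (ler_wpM2r (nm_ge0 w) sd) _.
    rewrite /d invfM mulrA divfK ?gt_eqF// ltr_pdivrMr// mulr_natr mulr2n.
    by rewrite ltrDl.
  have l1 : nm (s%:C * w - s0%:C * w) < r1 by rewrite (lt_le_trans lt_r)// ge_min lexx.
  have l2 : nm (s%:C * w - s0%:C * w) < r2.
    by rewrite (lt_le_trans lt_r)// ge_min lexx orbT.
  have := cvgC_D (h1 _ l1) (cvgC_Ml (c := -1) (h2 _ l2)).
  rewrite mulN1r; apply: eq_cvgC => n.
  rewrite /series /= mulr_sumr -big_split /=; apply: eq_bigr => k _.
  by rewrite E mulN1r mulrBl.
(* Only the points [s0 - s] behind the centre are known to be points of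
   agreement, so the series is read along [- w]. *)
have c12 n : c1 n - c2 n = 0.
  have m0 : 0 < Num.min d (s0 / 2) by rewrite lt_min d0 divr_gt0.
  have := @power_series_eq0 (fun n => (c1 n - c2 n) * (- w) ^+ n) _ m0 _ n.
  move=> H; apply: (mulIf (_ : (- w) ^+ n != 0)); rewrite ?mul0r.
    by rewrite expf_neq0// oppr_eq0.
  apply: H => s /andP[s_gt0]; rewrite le_min => /andP[sd ss0].
  have ss : `|s0 - s - s0| <= d by rewrite addrAC subrr add0r normrN gtr0_norm.
  have := near _ ss; rewrite below; last by apply/andP; split; lra.
  rewrite subrr; apply: eq_cvgC => N; rewrite /series /=; apply: eq_bigr => k _.
  rewrite -mulrA -exprMn; congr (_ * _ ^+ _).
  rewrite (_ : s0 - s - s0 = - s); last by ring.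
  have -> : (- s)%:C = - s%:C by exact: rmorphN.
  by ring.
have around s : `|s - s0| <= d -> g1 (s%:C * w) = g2 (s%:C * w).
  move=> /near h; apply/eqP; rewrite -subr_eq0; apply/eqP.
  apply: (cvgC_unique h); apply: (@eq_cvgC _ (fun=> 0)).
    by move=> n; rewrite /series /= big1// => k _; rewrite c12 mul0r.
  by apply/cvg_reimP; split; exact: cvg_cst.
pose s2 := Num.min 1 (s0 + d).
have s2P : P s2.
  move=> s' /andP[s'0 s's2].
  have [lt|ge] := ltP s' s0; first by apply: below; rewrite s'0.
  apply: around; rewrite ger0_norm ?subr_ge0// lerBlDl.
  by apply: (le_trans s's2); rewrite ge_min lexx orbT.
have s2A : A s2.
  split=> //; rewrite ge_min lexx /= andbT le_min ler01 /=; lra.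
have s2s0 : s2 <= s0 by exact: ub_le_sup supA.2 _ s2A.
have s01 : s0 = 1.
  apply/eqP; rewrite eq_le s0_le /= leNgt; apply/negP => lt1.
  by move: s2s0; rewrite ge_min; apply/negP; rewrite negb_or -!ltNge lt1 ltrDl d0.
have := s2P 1; rewrite mul1r; apply.
by rewrite ler01 /= le_min lexx /= s01 lerDl ltW.
Qed.

End IdentityTheorem.

(** * The continued hypergeometric function is Euler's integral *)

Section HypergeometricValue.
Variable R : realType.
Local Notation mu := (@lebesgue_measure R).
Local Notation I01 := (`]0, 1[%classic : set R).
Implicit Types (b c v q p w : R[i]).

Lemma ekernelDn (m sg : R) v q p eta gam n (u : R) : 0 < u < 1 ->
  ekernel m sg v q p (eta + n%:R) gam u = ekernel m sg v q p eta gam u * u%:C ^+ n.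
Proof.
by move=> /andP[u0 u1]; rewrite /ekernel cpow_posDn//; ring.
Qed.

(** Euler's integral is analytic on the cut plane and expands into the defining
    series on the unit disc, and the analytic continuation is unique. *)
Lemma eHyp_stieltjes (m sg : R) v q p r b c w : 0 <= m -> 0 <= sg ->
  0 < re p -> 0 < re (v + q + 2^-1) -> 0 < re (2 * v + q + 3 / 2) ->
  eHyp_exists m sg q b c w ->
  eHyp m sg v q p r.+1%:R b c w = (Num.sqrt (2 / pi))%:C / cBeta b (c - b) *
    stieltjes (ekernel m sg v q p b (c - b)) r w.
Proof.
move=> m0 sg0 p0 vq0 vb0 [b0 bc ex wcut].
have [hm hs] := ex 0%N; rewrite addr0 in hm.
have iK := cinteg_ekernel m0 sg0 p0 vq0 vb0 hm hs.
set K := ekernel m sg v q p b (c - b); set k := _ / cBeta _ _.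
pose g w := k * stieltjes K r w.
have gan w' : ~~ (1 <= w') -> analytic_at g w' by exact: stieltjes_analytic.
have gser w' : nm w' < 1 -> g w' = eHyp_series m sg v q p r.+1%:R b c w'.
  move=> w1; rewrite /eHyp_series.
  have h1 (u : R) : 0 < u < 1 -> 1 <= nm (1 - u%:C * 0) by rewrite mulr0 subr0 nm1.
  have w1' : nm (w' - 0) < 1 by rewrite subr0.
  have := cvgC_Ml (c := k) (@stieltjes_series R K iK r 0 w' 1 ltr01 h1 w1').
  move=> h; apply/esym/csumE; move: h; apply: eq_cvgC => n.
  rewrite /series /= mulr_sumr; apply: eq_bigr => j _; rewrite subr0.
  have -> : moment K r 0 j = 'C(j + r, j)%:R *
      cintegral I01 (ekernel m sg v q p (b + j%:R) (c - b)).
    rewrite -cintegralZ//; last first.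
      apply: cinteg_ekernel => //.
      by have [hj _] := ex j.
    apply: eq_cintegral => u /I01P u01.
    by rewrite mulr0 subr0 invr1 expr1n mulr1 ekernelDn// /K; ring.
  rewrite -poch_bin /eBeta /k -/(ekernel _ _ _ _ _ _ _).
  by move: (cBeta _ _)^-1 (j`!%:R^-1 : R[i]) => x y; ring.
have gC : eHyp_continuation m sg v q p r.+1%:R b c g.
  by split=> // w'; rewrite normr_nmE -[1]/((1 : R)%:C) ltcR; exact: gser.
rewrite /eHyp; set h := xget _ _.
have [han hser] : eHyp_continuation m sg v q p r.+1%:R b c h.
  exact: (@xgetI _ (eHyp_series m sg v q p r.+1%:R b c)
    [set g | eHyp_continuation m sg v q p r.+1%:R b c g] g gC).
rewrite -[RHS]/(g w); apply: (slit_identity han gan) => // w' w1.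
by rewrite gser// hser// normr_nmE -[1]/((1 : R)%:C) ltcR.
Qed.

End HypergeometricValue.

(** * The fractional derivative of a rational function *)

Section FractionalDerivative.
Variable R : realType.
Local Notation I01 := (`]0, 1[%classic : set R).
Implicit Types (v q p alpha eta w c : R[i]) (u : R).

Lemma preimage_scale (z : R) : 0 < z ->
  (fun t : R => 0 + z^-1 * t) @^-1` I01 = (`]0, z[%classic : set R).
Proof.
move=> z0; apply/seteqP; split=> t /=; rewrite !in_itv /= add0r.
  rewrite pmulr_rgt0 ?invr_gt0// => /andP[-> /=].
  by rewrite mulrC ltr_pdivrMr// mul1r.
move=> /andP[t0 tz]; rewrite mulr_gt0 ?invr_gt0//=.
by rewrite mulrC ltr_pdivrMr// mul1r.
Qed.

Lemma besselarg_scale (m sg : R) p (z u : R) : 0 < z -> 0 < u -> 0 < 1 - u ->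
  - p * (z `^ (m + sg))%:C / ((z * u) `^ m * (z * (1 - u)) `^ sg)%:C =
  - p / (u `^ m * (1 - u) `^ sg)%:C.
Proof.
move=> z0 u0 u1.
rewrite !powRM ?(ltW z0) ?(ltW u0) ?(ltW u1)//.
rewrite powRD; last by apply/implyP => _; rewrite gt_eqF.
have nz (x e : R) : 0 < x -> (x `^ e)%:C != 0.
  by move=> x0; rewrite -nm_gt0 nmR normr_gt0 gt_eqF// powR_gt0.
have MC (x y : R) : (x * y)%:C = x%:C * y%:C by exact: rmorphM.
rewrite !MC.
have := nz _ m z0; have := nz _ sg z0; have := nz _ m u0; have := nz _ sg u1.
move: ((z `^ m)%:C) ((z `^ sg)%:C) ((u `^ m)%:C) (((1 - u) `^ sg)%:C).
by move=> a b c d d0 c0 b0 a0; field; rewrite ?a0 ?b0 ?c0 ?d0.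
Qed.

(** The substitution [t = z u]: the powers of [z] combine to
    [z ^ (eta + alpha)], and inside the Bessel function they cancel. *)
Lemma eFracDeriv_scale (m sg : R) v q alpha eta p (f : R -> R[i]) (z : R) :
  0 < z ->
  cinteg I01 (fun u => ekernel m sg v q p eta (alpha - 1) u * f (z * u)) ->
  eFracDeriv m sg v q alpha eta p f z =
  (Num.sqrt (2 / pi))%:C / cGamma alpha * (cpow z%:C (eta + alpha) *
    cintegral I01 (fun u => ekernel m sg v q p eta (alpha - 1) u * f (z * u))).
Proof.
move=> z0 ig; rewrite /eFracDeriv; congr (_ * _).
have mI : measurable I01 by exact: measurable_itv.
have zi0 : z^-1 != 0 by rewrite invr_eq0 gt_eqF.
have jg := cinteg_affine 0 zi0 mI ig; rewrite preimage_scale// in jg.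
rewrite (cintegral_affine 0 zi0 mI ig) preimage_scale//.
rewrite gtr0_norm ?invr_gt0//.
(* The remaining factor [z] is the Jacobian of the substitution. *)
have zE : cpow z%:C (eta + alpha) * (z^-1)%:C =
    cpow z%:C (alpha - 1) * cpow z%:C eta.
  rewrite (_ : eta + alpha = (alpha - 1) + eta + 1); last by ring.
  rewrite (cpow_posD (alpha - 1 + eta) 1 z0) cpow_pos1//.
  rewrite (cpow_posD (alpha - 1) eta z0) -mulrA -rmorphM divff ?gt_eqF//.
  by rewrite mulr1.
rewrite mulrA zE -cintegralZ//; apply: eq_cintegral => t.
rewrite /= in_itv /= => /andP[t0 tz]; rewrite add0r.
set u := z^-1 * t.
have tE : t = z * u by rewrite /u mulVKf// gt_eqF.
have u0 : 0 < u by rewrite mulr_gt0// invr_gt0.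
have u1 : 0 < 1 - u.
  by rewrite subr_gt0 /u mulrC ltr_pdivrMr// mul1r.
have ztE : z - t = z * (1 - u) by rewrite tE; ring.
rewrite ztE tE (cpow_posM _ z0 u1) (cpow_posM _ z0 u0) /ekernel.
rewrite besselarg_scale//; ring.
Qed.

Lemma pole_scale (beta x : R[i]) (z u : R) r : x != 0 ->
  beta / (z%:C * u%:C - x) ^+ r =
  beta / (- x) ^+ r * (1 - u%:C * (z%:C / x))^-1 ^+ r.
Proof.
move=> x0; rewrite (_ : z%:C * u%:C - x = - x * (1 - u%:C * (z%:C / x))); last first.
  by field.
by rewrite exprMn exprVn invfM; exact: mulrA.
Qed.

Lemma horner_real_quadratic (z : R[i]) (t : R) :
  (real_quadratic z).[t] = (t - re z) ^+ 2 + (im z) ^+ 2.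
Proof.
rewrite /real_quadratic !hornerE.
have -> : nm z ^+ 2 = re z ^+ 2 + im z ^+ 2.
  case: z => a b; rewrite /= sqr_sqrtr// addr_ge0 ?sqr_ge0//.
by ring.
Qed.

Lemma real_quadratic_neq0 (z : R[i]) (t : R) : im z != 0 ->
  (real_quadratic z).[t] != 0.
Proof.
move=> h; rewrite horner_real_quadratic gt_eqF// ltr_wpDl ?sqr_ge0//.
by rewrite exprn_even_gt0.
Qed.

(** The contribution of one simple fraction. The Euler beta factor of the final
    formula cancels the one in the definition of the hypergeometric function
    because it does not vanish. *)
Lemma pole_term (m sg : R) v q alpha eta p w (beta zp : R[i]) r :
  0 <= m -> 0 <= sg ->
  0 < re p -> 0 < re (v + q + 2^-1) -> 0 < re (2 * v + q + 3 / 2) ->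
  eHyp_exists m sg q eta (eta + alpha - 1) w ->
  let h u := beta * (ekernel m sg v q p eta (alpha - 1) u *
    (1 - u%:C * w)^-1 ^+ r.+1) in
  cinteg I01 h /\
  (Num.sqrt (2 / pi))%:C / cGamma alpha * (zp * cintegral I01 h) =
  beta * (cBeta eta (alpha - 1) * zp / cGamma alpha) *
    eHyp m sg v q p r.+1%:R eta (eta + alpha - 1) w.
Proof.
move=> m0 sg0 p0 vq0 vb0 ex h.
have cbE : eta + alpha - 1 - eta = alpha - 1 by ring.
have [eta0 etac exk wcut] := ex.
have [hm hs] := exk 0%N; rewrite addr0 cbE in hm hs.
have al0 : 0 < re (alpha - 1) by rewrite -cbE reB subr_gt0.
have [d d0 hd] := slit_dist wcut.
have iK := cinteg_ekernel m0 sg0 p0 vq0 vb0 hm hs.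
have iS := @cinteg_stieltjes R _ iK r w d d0 hd.
have mI : measurable I01 by exact: measurable_itv.
split; first exact: cintegZ.
rewrite /h cintegralZ// (@eHyp_stieltjes R m sg v q p r _ _ _ m0 sg0 p0 vq0 vb0 ex) cbE /stieltjes.
have := cBeta_neq0 eta0 al0.
move: (cBeta _ _) (cGamma alpha)^-1 (cintegral _ _) => B g S B0.
by field.
Qed.

End FractionalDerivative.

Theorem theorem30 (R : realType) (mu sigma : R) (v q p alpha eta : R[i])
  (halpha : 0 < complex.Re alpha) (hp : 0 < complex.Re p)
  (heta : 0 < complex.Re eta)
  (hvq : 0 < complex.Re (v + q + 2^-1))
  (h2vq : 0 < complex.Re (2 * v + q + 3 / 2))
  (hmu : 0 <= mu) (hsigma : 0 <= sigma)
  (m n : nat) (x : 'I_m -> R) (zc : 'I_n -> R[i])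
  (k : 'I_m -> nat) (l : 'I_n -> nat)
  (hx0 : forall i, x i != 0) (hxinj : injective x)
  (hzim : forall j, complex.Im (zc j) != 0) (hzinj : injective zc)
  (hk : forall i, (0 < k i)%N) (hl : forall j, (0 < l j)%N)
  (hquad : injective (fun j => real_quadratic (zc j)))
  (P Q : {poly R})
  (hQ : Q = \prod_(i < m) ('X - (x i)%:P) ^+ k i *
            \prod_(j < n) real_quadratic (zc j) ^+ l j)
  (hdeg : (size P < size Q)%N)
  (a : 'I_m -> nat -> R) (b : 'I_n -> nat -> R[i])
  (hpf : forall t : R, Q.[t] != 0 ->
     (P.[t] / Q.[t])%:C =
       \sum_(i < m) \sum_(1 <= r < (k i).+1)
          ((a i r)%:C / (t%:C - (x i)%:C) ^+ r) +
       \sum_(j < n) \sum_(1 <= s < (l j).+1)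
          (b j s / (t%:C - zc j) ^+ s +
           conjc (b j s) / (t%:C - conjc (zc j)) ^+ s))
  (z : R) (hz : 0 < z)
  (hFx : forall i, eHyp_exists mu sigma q eta (eta + alpha - 1)
                     (z%:C / (x i)%:C))
  (hFz : forall j, eHyp_exists mu sigma q eta (eta + alpha - 1)
                     (z%:C / zc j))
  (hFzc : forall j, eHyp_exists mu sigma q eta (eta + alpha - 1)
                      (z%:C / conjc (zc j))) :
  eFracDeriv mu sigma v q alpha eta p (fun t : R => (P.[t] / Q.[t])%:C) z =
  \sum_(i < m) \sum_(1 <= r < (k i).+1)
     ((a i r)%:C * cBeta eta (alpha - 1) * cpow z%:C (eta + alpha) /
        ((- (x i)%:C) ^+ r * cGamma alpha) *
      eHyp mu sigma v q p r%:R eta (eta + alpha - 1) (z%:C / (x i)%:C)) +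
  \sum_(j < n) \sum_(1 <= s < (l j).+1)
     (b j s * (cBeta eta (alpha - 1) * cpow z%:C (eta + alpha) /
                 ((- zc j) ^+ s * cGamma alpha)) *
      eHyp mu sigma v q p s%:R eta (eta + alpha - 1) (z%:C / zc j) +
      conjc (b j s) * (cBeta eta (alpha - 1) * cpow z%:C (eta + alpha) /
                 ((- conjc (zc j)) ^+ s * cGamma alpha)) *
      eHyp mu sigma v q p s%:R eta (eta + alpha - 1) (z%:C / conjc (zc j))).
Proof.
set K := ekernel mu sigma v q p eta (alpha - 1).
set zp := cpow z%:C (eta + alpha).
have mI : measurable (`]0, 1[%classic : set R) by exact: measurable_itv.
have xC0 i : (x i)%:C != 0 :> R[i] by rewrite -nm_gt0 nmR normr_gt0.
have zC0 j : zc j != 0.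
  by apply: contraNneq (hzim j) => ->.
have zcC0 j : conjc (zc j) != 0 by rewrite conjc_eq0.
pose T (beta w : R[i]) r (u : R) := beta * (K u * (1 - u%:C * w)^-1 ^+ r.+1).
pose tx i r := T ((a i r.+1)%:C / (- (x i)%:C) ^+ r.+1) (z%:C / (x i)%:C) r.
pose tz j s := T (b j s.+1 / (- zc j) ^+ s.+1) (z%:C / zc j) s.
pose tc j s := T (conjc (b j s.+1) / (- conjc (zc j)) ^+ s.+1)
  (z%:C / conjc (zc j)) s.
have px i r := @pole_term R mu sigma v q alpha eta p _
  ((a i r.+1)%:C / (- (x i)%:C) ^+ r.+1) zp r
  hmu hsigma hp hvq h2vq (hFx i).
have pz j s := @pole_term R mu sigma v q alpha eta p _
  (b j s.+1 / (- zc j) ^+ s.+1) zp s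
  hmu hsigma hp hvq h2vq (hFz j).
have pc j s := @pole_term R mu sigma v q alpha eta p _
  (conjc (b j s.+1) / (- conjc (zc j)) ^+ s.+1) zp s
  hmu hsigma hp hvq h2vq (hFzc j).
(* A root [z u = x i] would put [z / x i = u^-1] on the excluded half-line. *)
have Qn0 u : 0 < u < 1 -> Q.[z * u] != 0.
  move=> /andP[u0 u1]; rewrite hQ hornerM !horner_prod mulf_neq0//.
  - apply/prodf_neq0 => i _; rewrite horner_exp !hornerE expf_neq0// subr_eq0.
    apply: contraL (isT) => /eqP E; have [_ _ _] := hFx i.
    rewrite slitE negb_and; apply: contraTN => _.
    have -> : z%:C / (x i)%:C = (u^-1)%:C.
      rewrite -E; rewrite (_ : (z * u)%:C = z%:C * u%:C); last exact: rmorphM.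
      rewrite invfM mulrA divff ?mul1r; last by rewrite -nm_gt0 nmR normr_gt0 gt_eqF.
      by symmetry; exact: fmorphV.
    by rewrite /= eqxx /= -ltNge invf_lt1// ltNge ltW.
  - by apply/prodf_neq0 => j _; rewrite horner_exp expf_neq0// real_quadratic_neq0.
have fE u : 0 < u < 1 -> K u * (P.[z * u] / Q.[z * u])%:C =
    \sum_(i < m) \sum_(0 <= r < k i) tx i r u +
    \sum_(j < n) \sum_(0 <= s < l j) (tz j s u + tc j s u).
  move=> u01; rewrite hpf ?Qn0// mulrDr !mulr_sumr.
  have MC : (z * u)%:C = z%:C * u%:C :> R[i] by exact: rmorphM.
  congr (_ + _); apply: eq_bigr => i _; rewrite big_add1 /= mulr_sumr;
    apply: eq_bigr => r _; rewrite MC.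
  - by rewrite pole_scale// /tx /T; move: (_ / _ ^+ _) => beta; ring.
  - rewrite !pole_scale// /tz /tc /T.
    by move: (b i r.+1 / _) (_^*%C / _) => beta beta'; ring.
have ix i r : cinteg (`]0, 1[%classic : set R) (tx i r) by have [] := px i r.
have iz j s : cinteg (`]0, 1[%classic : set R) (tz j s) by have [] := pz j s.
have ic j s : cinteg (`]0, 1[%classic : set R) (tc j s) by have [] := pc j s.
have izc j s : cinteg (`]0, 1[%classic : set R) (fun u => tz j s u + tc j s u).
  exact: cintegD.
have isx i : cinteg (`]0, 1[%classic : set R) (fun u => \sum_(0 <= r < k i) tx i r u).
  exact: cinteg_sum.
have isz j : cinteg (`]0, 1[%classic : set R)
    (fun u => \sum_(0 <= s < l j) (tz j s u + tc j s u)).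
  exact: cinteg_sum.
have jx := cinteg_sum (index_enum 'I_m) mI isx.
have jz := cinteg_sum (index_enum 'I_n) mI isz.
rewrite eFracDeriv_scale//; last first.
  apply: eq_cinteg (cintegD mI jx jz) => // u /I01P u01.
  by rewrite -fE.
rewrite (eq_cintegral (h2 := fun u =>
    \sum_(i < m) \sum_(0 <= r < k i) tx i r u +
    \sum_(j < n) \sum_(0 <= s < l j) (tz j s u + tc j s u))); last first.
  by move=> u /I01P; exact: fE.
rewrite cintegralD// !cintegral_sum// mulrDr mulrDr !mulr_sumr.
congr (_ + _); apply: eq_bigr => i _;
  rewrite cintegral_sum// big_add1 /= !mulr_sumr; apply: eq_bigr => r _.
- have [_ ->] := px i r; rewrite [((- _) ^+ _ * _)^-1]invfM.
  by move: ((- _) ^+ _)^-1 (cGamma alpha)^-1 => y g; ring.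
- rewrite cintegralD// mulrDr mulrDr; congr (_ + _).
  + have [_ E] := pz i r; apply: (etrans E); rewrite [((- _) ^+ _ * _)^-1]invfM.
    by move: ((- _) ^+ _)^-1 (cGamma alpha)^-1 => y g; ring.
  + have [_ E] := pc i r; apply: (etrans E); rewrite [((- _) ^+ _ * _)^-1]invfM.
    by move: ((- _) ^+ _)^-1 (cGamma alpha)^-1 => y g; ring.
Qed.
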